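(* Let $f(z)=\sum_{n=0}^\infty a_n z^n$ be a non-constant analytic function in the unit disk $\mathbb D$ and let $(X_n)_{n\geq 0}$ be an independent centred subgaussian sequence of (real or complex) random variables. Then $\sum_{n=0}^\infty a_n X_n z^n$ defines almost surely an analytic function in $\mathbb D$. Moreover, for every $\delta>0$ there exist a (deterministic) set $E\subset[0,1)$ of finite logarithmic measure and a (deterministic) constant $C>0$ such that, almost surely, there exists $r_0\in(0,1)$ such that $$\max_{|z|=r}\Big|\sum_{n=0}^\infty a_nX_nz^n\Big|\leq C\,\frac{\mu_f(r)}{(1-r)^{\frac12}}\Big(\log\frac1{1-r}\Big)^{\frac34+\delta}\Big(\log\frac{\mu_f(r)}{1-r}\Big)^{\frac14}\Big(\log\log\frac{\mu_f(r)}{1-r}\Big)^{1+\delta}$$ for every $r$ with $r_0\leq r<1$ and $r\notin E$.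
   Context: $\mathbb D=\{z\in\mathbb C:|z|<1\}$. All random variables are real or complex valued and defined on a probability space $(\Omega,\mathcal A,\mathbb P)$. A random variable $X$ is subgaussian if there are constants $K,\tau>0$ with $\mathbb P(|X|>t)\leq Ke^{-t^2/\tau^2}$ for all $t\geq 0$. A sequence $(X_n)_{n\ge 0}$ is subgaussian if every $X_n$ is subgaussian with the same constants $K,\tau$; it is centred if $\mathbb E(X_n)=0$ for all $n$; it is independent if the $X_n$ are independent. For $f(z)=\sum_{n=0}^\infty a_nz^n$, the maximum term is $\mu_f(r)=\max_{n\geq 0}|a_n|r^n$, $0\le r<1$. A measurable set $E\subset[0,1)$ is of finite logarithmic measure if $\int_{E}\frac1{1-r}\,dr<\infty$. The number $r_0$ may depend on $\omega\in\Omega$, whereas $E$ and $C$ do not. *)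

(* Defs.v *)
From HB Require Import structures.
From mathcomp Require Import all_boot all_order all_algebra finmap.
From mathcomp Require Import complex.
From mathcomp Require Import all_classical all_reals all_analysis.

Set Implicit Arguments.
Unset Strict Implicit.
Unset Printing Implicit Defensive.

Import Order.TTheory GRing.Theory Num.Theory.
Import numFieldNormedType.Exports.

Local Open Scope classical_set_scope.
Local Open Scope complex_scope.
Local Open Scope ring_scope.

(* The topology and normed-module structure that every numFieldType carries,
   made available on R[i] itself. *)
HB.instance Definition _ (R : realType) := NormedModule.copy R[i] R[i]^o.

(* The R-valued modulus: Num.norm on R[i] takes its values in R[i], and
   `|z| is (modulus z)%:C. *)
Definition modulus (R : realType) (z : R[i]) : R := ComplexField.Normc.normc z.

Definition unit_disk (R : realType) : set R[i] := [set z | modulus z < 1].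

(* [derivable] is taken over the scalar field R[i], so this is complex
   differentiability. *)
Definition analytic_in_disk (R : realType) (f : R[i] -> R[i]) : Prop :=
  forall z, unit_disk z -> derivable f z 1.

Definition power_series (R : realType) (a : nat -> R[i]) (z : R[i]) :
  nat -> R[i] := [series a n * z ^+ n]_n.

Definition power_series_sum (R : realType) (a : nat -> R[i]) (z : R[i]) : R[i] :=
  limn (power_series a z).

(* The maximum is attained when 0 <= r < 1 and the power series of coefficients
   a converges in the unit disk, since then |a_n| r^n tends to 0. *)
Definition maximum_term (R : realType) (a : nat -> R[i]) (r : R) : R :=
  sup (range (fun n => modulus (a n) * r ^+ n)).

(* Extended-real valued, so that no default value is used for a function that is
   unbounded on the circle. *)
Definition maximum_modulus (R : realType) (g : R[i] -> R[i]) (r : R) : \bar R :=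
  ereal_sup [set (modulus (g z))%:E | z in [set z | modulus z = r]].

(* C is identified with R * R, whose product sigma-algebra is the Borel one. *)
Definition re_im (R : realType) (z : R[i]) : R * R :=
  (complex.Re z, complex.Im z).

Section random_sequences.
Context (d : measure_display) (T : measurableType d) (R : realType).
Context (P : probability T R).

Definition complex_random_variable (Y : T -> R[i]) : Prop :=
  measurable_fun [set: T] (fun w => re_im (Y w)).

Definition independent_sequence (X : nat -> T -> R[i]) : Prop :=
  forall (J : {fset nat}) (B : nat -> set (R * R)),
    (forall n, n \in J -> measurable (B n)) ->
    P (\bigcap_(n in [set` J]) ((fun w => re_im (X n w)) @^-1` B n)) =
    (\prod_(n <- J) P ((fun w => re_im (X n w)) @^-1` B n))%E.

(* The library's convention +oo - +oo = -oo makes a vanishing expectation imply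
   integrability. *)
Definition centred (Y : T -> R[i]) : Prop :=
  'E_P[fun w => complex.Re (Y w)]%E = 0%E /\
  'E_P[fun w => complex.Im (Y w)]%E = 0%E.

Definition subgaussian_with (K tau : R) (Y : T -> R[i]) : Prop :=
  forall t : R, 0 <= t ->
    (P [set w | (t < modulus (Y w))%R] <= (K * expR (- (t ^+ 2 / tau ^+ 2)))%:E)%E.

Definition subgaussian_sequence (X : nat -> T -> R[i]) : Prop :=
  exists K tau : R, 0 < K /\ 0 < tau /\ forall n, subgaussian_with K tau (X n).

Definition random_coefficients (a : nat -> R[i]) (X : nat -> T -> R[i]) (w : T) :
  nat -> R[i] := fun n => a n * X n w.

End random_sequences.

Definition finite_log_measure (R : realType) (E : set R) : Prop :=
  (\int[@lebesgue_measure R]_(r in E) ((1 - r)^-1)%:E < +oo)%E.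

(* Main.v *)
(* Let b_n = |a_n|^2 (plus a large constant at n = 0), let Phi(r) be the sum of
   the b_n r^(2n), and let m and s be the mean and the variance of n under the
   probabilities b_n r^(2n) / Phi(r).
   - Chebyshev's inequality gives Phi <= C (sqrt s + 1) mu_f^2 (Rosenbloom's method).
     Both m and s are, up to a factor, derivatives in r, namely of u = ln Phi and
     of m. A Borel-Nevanlinna growth lemma, applied to u and to e + m, bounds m and s
     by means of u outside a set of finite logarithmic measure; then u itself is
     bounded by a multiple of ln (mu_f / (1 - r)).
   - A centred subgaussian X satisfies E exp(Re(c X)) <= exp(kappa |c|^2). Summing
     exponential moments over all degrees N and over a grid of polynomial size in
     N, almost surely |p_N(y)| <= (C sqrt(ln N) + Z) sqrt(Phi(|y|)) for the N-th
     random partial sum p_N, all N and all grid points y, with a random Z.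
   - For |z| = r the degree N = (2 (s + m^2 + 1))^2 suffices: the tail and the step
     from z to a grid point are controlled by a random W bounding the sum of
     |X_n|^2 (n + 1)^(-3/2), and ln N is at most a multiple of ln(1/(1-r)) ln u.
     The random constants are absorbed as r tends to 1. *)
Require Import Defs.
From mathcomp Require Import all_boot all_order all_algebra finmap.
From mathcomp Require Import complex ring lra.
From mathcomp Require Import all_classical all_reals all_analysis measurable_realfun.

Set Implicit Arguments.
Unset Strict Implicit.
Unset Printing Implicit Defensive.

Import Order.TTheory GRing.Theory Num.Theory.
Import numFieldNormedType.Exports.

Local Open Scope classical_set_scope.
Local Open Scope complex_scope.
Local Open Scope ring_scope.

(** The circle [|z| = r] is uncountable and the degree [N] used there depends on [r], so no union
    bound can be made circle by circle. Taking all [N] and, for each, all points of a grid of mesh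
    [(N+1)^(-3)] leaves one countable family, hence one null set that serves every [r]. Only
    [sqrt (ln N)] enters the final bound, so polynomial bounds on [N] are enough. Origin of the
    exponents: put [D = 1/(1-r)] and [L = ln D]. Up to powers of [ln u] and [L^e], the growth lemma
    gives [m] of order [D u] and [s] of order [D^2 u L]. Thus [sqrt Phi] is of order [mu_f s^(1/4)],
    that is [mu_f D^(1/2) u^(1/4) L^(1/4)], and [sqrt (ln N)] supplies another [L^(1/2)], whence
    [3/4]; the factor [u^(1/4)] becomes the power [1/4] of [ln (mu_f / (1-r))]. The large constant
    in [b_0] keeps [ln Phi >= e] on the whole disk, so that the growth lemma, which divides by
    powers of [ln u], applies from [r = 0] on. *)

Lemma modulusM (R : realType) (x y : R[i]) : modulus (x * y) = modulus x * modulus y.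
Proof. exact: ComplexField.Normc.normcM. Qed.

Lemma modulus0 (R : realType) : modulus (0 : R[i]) = 0.
Proof. exact: ComplexField.Normc.normc0. Qed.

Lemma modulus1 (R : realType) : modulus (1 : R[i]) = 1.
Proof. exact: ComplexField.Normc.normc1. Qed.

Lemma modulusX (R : realType) (x : R[i]) n : modulus (x ^+ n) = modulus x ^+ n.
Proof. by elim: n => [|n IH]; rewrite ?expr0 ?modulus1// !exprS modulusM IH. Qed.

Lemma modulusV (R : realType) (x : R[i]) : modulus x^-1 = (modulus x)^-1.
Proof. exact: ComplexField.Normc.normcV. Qed.

Lemma modulusN (R : realType) (x : R[i]) : modulus (- x) = modulus x.
Proof. exact: normcN. Qed.

Lemma modulusB (R : realType) (x y : R[i]) : modulus (x - y) = modulus (y - x).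
Proof. by rewrite -modulusN opprB. Qed.

Lemma ler_modulusD (R : realType) (x y : R[i]) : modulus (x + y) <= modulus x + modulus y.
Proof. exact: le_normcD. Qed.

Lemma modulus_ge0 (R : realType) (x : R[i]) : 0 <= modulus x.
Proof. by case: x => a b; rewrite /modulus/= sqrtr_ge0. Qed.

Lemma modulus_norm (R : realType) (x : R[i]) : `|x| = (modulus x)%:C.
Proof. by []. Qed.

Lemma sqr_modulus (R : realType) (x : R[i]) :
  modulus x ^+ 2 = complex.Re x ^+ 2 + complex.Im x ^+ 2.
Proof. by case: x => a b; rewrite /modulus/= sqr_sqrtr// addr_ge0 ?sqr_ge0. Qed.

Lemma modulus_nat (R : realType) n : modulus (n%:R : R[i]) = n%:R.
Proof.
elim: n => [|n IH]; first by rewrite modulus0.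
rewrite -[in LHS](rmorph_nat (real_complex R)) /modulus /= expr0n/= addr0.
by rewrite sqrtr_sqr ger0_norm.
Qed.

Lemma norm_Re_modulus (R : realType) (x : R[i]) : `|complex.Re x| <= modulus x.
Proof.
rewrite -(@ler_pXn2r _ 2) ?nnegrE ?modulus_ge0// sqr_modulus real_normK ?num_real//.
by rewrite lerDl sqr_ge0.
Qed.

Lemma norm_Im_modulus (R : realType) (x : R[i]) : `|complex.Im x| <= modulus x.
Proof.
rewrite -(@ler_pXn2r _ 2) ?nnegrE ?modulus_ge0// sqr_modulus real_normK ?num_real//.
by rewrite lerDr sqr_ge0.
Qed.

Lemma modulus_le_ReIm (R : realType) (x : R[i]) :
  modulus x <= `|complex.Re x| + `|complex.Im x|.
Proof.
rewrite -(@ler_pXn2r _ 2) ?nnegrE ?modulus_ge0 ?addr_ge0// sqr_modulus sqrrD.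
by rewrite !real_normK ?num_real// -addrA lerD2l lerDr mulrn_wge0 ?mulr_ge0.
Qed.

Lemma modulus_sum (R : realType) (u : nat -> R[i]) m n :
  modulus (\sum_(m <= k < n) u k) <= \sum_(m <= k < n) modulus (u k).
Proof.
elim/big_ind2 : _ => //; first by rewrite modulus0.
by move=> x1 x2 y1 y2 h1 h2; apply: le_trans (ler_modulusD _ _) _; exact: lerD.
Qed.

Lemma Re_sub (R : realType) (x y : R[i]) :
  complex.Re (x - y) = complex.Re x - complex.Re y.
Proof. by case: x => ? ?; case: y. Qed.

Lemma Im_sub (R : realType) (x y : R[i]) :
  complex.Im (x - y) = complex.Im x - complex.Im y.
Proof. by case: x => ? ?; case: y. Qed.

Lemma Re_add (R : realType) (x y : R[i]) :
  complex.Re (x + y) = complex.Re x + complex.Re y.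
Proof. by case: x => ? ?; case: y. Qed.

Lemma Re_sum (R : realType) (I : Type) (r : seq I) (P : pred I) (u : I -> R[i]) :
  complex.Re (\sum_(k <- r | P k) u k) = \sum_(k <- r | P k) complex.Re (u k).
Proof. exact: (big_morph _ (@Re_add R) erefl). Qed.

Lemma Im_add (R : realType) (x y : R[i]) :
  complex.Im (x + y) = complex.Im x + complex.Im y.
Proof. by case: x => ? ?; case: y. Qed.

Lemma Im_sum (R : realType) (I : Type) (r : seq I) (P : pred I) (u : I -> R[i]) :
  complex.Im (\sum_(k <- r | P k) u k) = \sum_(k <- r | P k) complex.Im (u k).
Proof. exact: (big_morph _ (@Im_add R) erefl). Qed.

(** A positive element of [R[i]] has zero imaginary part, so real radii describe all balls of the
    topology. *)
Lemma cvg_modulusP (R : realType) (T : Type) (F : set_system T) (FF : Filter F)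
    (f : T -> R[i]) (l : R[i]) :
  f @ F --> l <-> forall e : R, 0 < e -> \forall t \near F, modulus (l - f t) < e.
Proof.
split => [/cvgrPdist_lt fl e e0|fl].
  have e0' : 0 < e%:C by rewrite ltcR.
  by have := fl _ e0'; apply: filterS => t; rewrite modulus_norm ltcR.
apply/cvgrPdist_lt => -[e e'] /[!ltcE]/= /andP[/eqP -> e0].
by have := fl _ e0; apply: filterS => t; rewrite modulus_norm ltcR.
Qed.

(** Real and imaginary parts are dominated by the modulus, so the real comparison test applies to
    each. *)
Lemma cvg_series_modulus (R : realType) (u : nat -> R[i]) (v : nat -> R) :
  (forall n, modulus (u n) <= v n) -> cvgn (series v) -> cvgn (series u).
Proof.
move=> uv cv.
have H (g : R[i] -> R) : (forall z, `|g z| <= modulus z) ->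
    cvgn (series (fun n => g (u n))).
  move=> gm; apply: normed_cvg; apply: series_le_cvg cv => n; [exact: normr_ge0| |].
    exact: le_trans (modulus_ge0 (u n)) (uv n).
  exact: le_trans (gm _) (uv n).
have /cvg_ex[l1 h1] := H _ (@norm_Re_modulus R).
have /cvg_ex[l2 h2] := H _ (@norm_Im_modulus R).
apply/cvg_ex; exists (l1 +i* l2); apply/cvg_modulusP => e e0.
have e2 : 0 < e / 2 by rewrite divr_gt0.
move/cvgrPdist_lt : h1 => /(_ _ e2) h1; move/cvgrPdist_lt : h2 => /(_ _ e2) h2.
near=> n; apply: le_lt_trans (modulus_le_ReIm _) _.
have -> : e = e / 2 + e / 2 by field.
rewrite Re_sub Im_sub /series/= Re_sum Im_sum.
apply: ltrD; near: n; [exact: h1|exact: h2].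
Unshelve. all: end_near. Qed.

Lemma modulus_lim_le (R : realType) (u : nat -> R[i]) (B : R) :
  cvgn u -> (\forall n \near \oo, modulus (u n) <= B) -> modulus (limn u) <= B.
Proof.
move=> cu uB; apply/ler_addgt0Pr => e e0.
move/cvg_modulusP : cu => /(_ _ e0) ue.
have [n [h1 h2]] : exists n, modulus (limn u - u n) < e /\ modulus (u n) <= B.
  by near \oo => n; exists n; split; near: n.
rewrite -[limn u](subrK (u n)); apply: le_trans (ler_modulusD _ _) _.
by rewrite addrC lerD// ltW.
Unshelve. all: end_near. Qed.

(** * Power series with radius of convergence at least 1 *)

(* Equivalently, the radius of convergence of [al] is at least 1. *)
Definition disk_bounded (R : realType) (al : nat -> R) :=
  forall rho : R, 0 < rho < 1 -> exists K, forall n, `|al n| * rho ^+ n <= K.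

(** Each of the [n + 1] summands of [1 + q + ... + q^n] is at least [q^n], and the sum is
    [(1 - q^(n+1)) / (1 - q)]. *)
Lemma ler_muln_geometric (R : realType) (q : R) n : 0 <= q < 1 ->
  n.+1%:R * q ^+ n <= (1 - q)^-1.
Proof.
move=> /andP[q0 q1]; have q1' : 0 < 1 - q by rewrite subr_gt0.
rewrite -[leRHS]mul1r ler_pdivlMr// mulrC.
suff : n.+1%:R * q ^+ n * (1 - q) <= 1 - q ^+ n.+1.
  by rewrite mulrC => /le_trans; apply; rewrite lerBlDr lerDl exprn_ge0.
elim: n => [|n IH]; first by rewrite expr0 !mul1r expr1.
move/(ler_wpM2l q0): IH.
have : 0 <= q ^+ n by rewrite exprn_ge0.
have : 0 <= (1 - q) * (1 - q * q ^+ n).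
  by rewrite mulr_ge0 ?subr_ge0 ?(ltW q1)// -exprS exprn_ile1 // ltW.
rewrite !exprS -[n.+2%:R]natr1; move: (q ^+ n) => x h1 h2 h3; lra.
Qed.

(** Pass to the radius [s] halfway between [rho] and 1: the factor [(n+1) (rho/s)^n] is bounded. *)
Lemma disk_bounded_mulS (R : realType) (al : nat -> R) :
  disk_bounded al -> disk_bounded (fun n => n.+1%:R * al n).
Proof.
move=> H rho /andP[r0 r1]; pose s := (1 + rho) / 2.
have s01 : 0 < s < 1 by rewrite /s; apply/andP; split; lra.
have [K HK] := H s s01; have /andP[s0 s1] := s01.
exists (K * (1 - rho / s)^-1) => n.
have -> : `|n.+1%:R * al n| * rho ^+ n =
    (`|al n| * s ^+ n) * (n.+1%:R * (rho / s) ^+ n).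
  rewrite normrM (ger0_norm (ler0n _ _)) (expr_div_n rho).
  have : s ^+ n != 0 by rewrite expf_neq0// gt_eqF.
  move: (s ^+ n) (rho ^+ n) => X Y X0. by field.
have q0 : 0 <= rho / s by rewrite divr_ge0 ?ltW.
apply: ler_pM; [|by rewrite mulr_ge0 ?exprn_ge0|exact: HK|].
  by rewrite mulr_ge0 ?exprn_ge0 ?(ltW s0).
apply: ler_muln_geometric; rewrite divr_ge0 ?ltW//= ltr_pdivrMr// mul1r /s; lra.
Qed.

Lemma disk_bounded_shift (R : realType) (al : nat -> R) :
  disk_bounded al -> disk_bounded (fun n => al n.+1).
Proof.
move=> H rho /andP[r0 r1]; have [|K HK] := H rho; first by rewrite r0.
exists (K / rho) => n; rewrite ler_pdivlMr// -mulrA -exprSr; exact: HK.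
Qed.

(** Split [rho] as a product of two copies of [sqrt rho], one for each factor. *)
Lemma disk_boundedM (R : realType) (al be : nat -> R) :
  disk_bounded al -> disk_bounded be -> disk_bounded (fun n => al n * be n).
Proof.
move=> H1 H2 rho /andP[r0 r1]; pose s := Num.sqrt rho.
have s01 : 0 < s < 1 by rewrite sqrtr_gt0 r0/= -sqrtr1 ltr_sqrt.
have [K HK] := H1 s s01; have [K' HK'] := H2 s s01; have /andP[s0 _] := s01.
exists (K * K') => n.
have -> : rho = s * s by rewrite -expr2 sqr_sqrtr// ltW.
by rewrite exprMn normrM mulrACA ler_pM ?mulr_ge0 ?exprn_ge0// ltW.
Qed.

Lemma disk_bounded_le (R : realType) (al be : nat -> R) (W : R) : 0 <= W ->
  (forall n, `|be n| <= W * `|al n|) -> disk_bounded al -> disk_bounded be.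
Proof.
move=> W0 H H1 rho /[dup] r01 /andP[r0 r1]; have [K HK] := H1 rho r01.
exists (W * K) => n; apply: le_trans (_ : W * `|al n| * rho ^+ n <= _).
  by rewrite ler_wpM2r// exprn_ge0// ltW.
by rewrite -mulrA ler_wpM2l.
Qed.

Lemma disk_bounded_cvg (R : realType) (al : nat -> R) (x : R) :
  disk_bounded al -> 0 <= x < 1 -> cvgn (series (fun n => `|al n| * x ^+ n)).
Proof.
move=> H /andP[x0 x1]; pose s := (1 + x) / 2.
have s01 : 0 < s < 1 by rewrite /s; apply/andP; split; lra.
have [K HK] := H s s01; have /andP[s0 s1] := s01.
have q0 : 0 <= x / s by exact: divr_ge0 x0 (ltW s0).
have q1 : `|x / s| < 1.
  by rewrite (ger0_norm q0) ltr_pdivrMr// mul1r /s; lra.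
apply: (series_le_cvg _ _ _ (@is_cvg_geometric_series _ K _ q1)) => n.
- exact: mulr_ge0 (normr_ge0 _) (exprn_ge0 n x0).
- have K0 : 0 <= K by apply: le_trans (HK 0%N); rewrite mulr1.
  exact: mulr_ge0 K0 (exprn_ge0 n q0).
- rewrite /geometric/= expr_div_n mulrA ler_pdivlMr ?exprn_gt0//.
  by rewrite mulrAC ler_wpM2r ?exprn_ge0.
Qed.

Lemma power_series_cvg (R : realType) (c : nat -> R[i]) (z : R[i]) :
  disk_bounded (fun n => modulus (c n)) -> unit_disk z -> cvgn (power_series c z).
Proof.
move=> H z1; apply: (@cvg_series_modulus _ _
  (fun n => `|modulus (c n)| * modulus z ^+ n)) => [n|].
  by rewrite modulusM modulusX ger0_norm// modulus_ge0.
by apply: disk_bounded_cvg => //; rewrite modulus_ge0.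
Qed.

(** Second-order Taylor remainder of a power. Writing [D_n] for the remainder of the exponent
    [n + 1], one has [D_(n+1) = (z + h) D_n + (n+1) z^n h^2], and [(n+1)^2 + (n+1) <= (n+2)^2]
    closes the induction. The factor [rho] on the left avoids the exponent [n - 1]. *)
Lemma expr_taylor2 (R : realType) (z h : R[i]) (rho : R) n :
  modulus z <= rho -> modulus (z + h) <= rho ->
  modulus ((z + h) ^+ n.+1 - z ^+ n.+1 - n.+1%:R * z ^+ n * h) * rho <=
    n.+1%:R ^+ 2 * rho ^+ n * modulus h ^+ 2.
Proof.
move=> zr zhr; have r0 : 0 <= rho by apply: le_trans (modulus_ge0 z) zr.
elim: n => [|n IH].
  rewrite !expr1 expr0 !mul1r (addrC z) addrK subrr modulus0 mul0r.
  by rewrite expr0 expr1n !mul1r sqr_ge0.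
set D := (X in modulus X) in IH.
have -> : (z + h) ^+ n.+2 - z ^+ n.+2 - n.+2%:R * z ^+ n.+1 * h =
  (z + h) * D + n.+1%:R * z ^+ n * h ^+ 2.
  by rewrite /D !exprS -!natr1; ring.
have H1 : modulus ((z + h) * D) <= rho * modulus D.
  by rewrite modulusM ler_wpM2r ?modulus_ge0.
have H2 : modulus (n.+1%:R * z ^+ n * h ^+ 2) <= n.+1%:R * rho ^+ n * modulus h ^+ 2.
  rewrite modulusM modulusX modulusM modulusX modulus_nat.
  apply: ler_wpM2r; first by rewrite exprn_ge0 ?modulus_ge0.
  by apply: ler_wpM2l => //; rewrite lerXn2r// nnegrE modulus_ge0.
have H3 := ler_modulusD ((z + h) * D) (n.+1%:R * z ^+ n * h ^+ 2).
have {}H3 := le_trans H3 (lerD H1 H2).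
have /le_trans -> // := ler_wpM2r r0 H3.
have H4 := ler_wpM2l r0 IH.
have P : 0 <= rho ^+ n.+1 * modulus h ^+ 2 by rewrite mulr_ge0 ?exprn_ge0 ?modulus_ge0.
have M0 : 0 <= n.+1%:R :> R by [].
have -> : (rho * modulus D + n.+1%:R * rho ^+ n * modulus h ^+ 2) * rho =
  rho * (modulus D * rho) + n.+1%:R * (rho ^+ n.+1 * modulus h ^+ 2).
  by rewrite (exprS rho); ring.
rewrite -[n.+2%:R]natr1.
have -> : (n.+1%:R + 1) ^+ 2 * rho ^+ n.+1 * modulus h ^+ 2 =
  (n.+1%:R + 1) ^+ 2 * (rho ^+ n.+1 * modulus h ^+ 2) :> R by ring.
have H5 : rho * (n.+1%:R ^+ 2 * rho ^+ n * modulus h ^+ 2) =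
   n.+1%:R ^+ 2 * (rho ^+ n.+1 * modulus h ^+ 2).
  by rewrite (exprS rho); ring.
rewrite H5 in H4.
apply: le_trans (lerD H4 (lexx _)) _.
rewrite -mulrDl ler_wpM2r//; nra.
Qed.

(** Termwise differentiation with an explicit error: the Taylor remainders of the powers add up to
    at most [L |h|^2 / rho^2], where [L] is the sum of the [(n+1)^2 |c_n| rho^n], so the difference
    quotient is within [O(|h|)] of the derived series. *)
Lemma power_series_analytic (R : realType) (c : nat -> R[i]) :
  disk_bounded (fun n => modulus (c n)) -> analytic_in_disk (power_series_sum c).
Proof.
move=> H z z1; pose rho := (1 + modulus z) / 2.
have z1' : modulus z < 1 := z1.
have z0 := modulus_ge0 z.
have rz : modulus z < rho by rewrite /rho; lra.
have r1 : rho < 1 by rewrite /rho; lra.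
have r0 : 0 < rho by rewrite /rho; lra.
pose b n := n.+1%:R * (n.+1%:R * modulus (c n)).
have Hb : disk_bounded b by do 2 apply: disk_bounded_mulS.
have cb : cvgn (series (fun n => `|b n| * rho ^+ n)).
  by apply: disk_bounded_cvg; rewrite // ltW.
pose d n : R[i] := n.+1%:R * c n.+1.
have Hd : disk_bounded (fun n => modulus (d n)).
  have := disk_bounded_shift Hb; apply: (@disk_bounded_le _ _ _ 1) => // n.
  rewrite mul1r /b /d modulusM modulus_nat !ger0_norm ?mulr_ge0 ?modulus_ge0//.
  rewrite mulrA ler_wpM2r ?modulus_ge0//.
  have : 0 <= n%:R :> R by [].
  rewrite -!natr1 => h; nra.
have cd := power_series_cvg Hd z1.
apply/cvg_ex; exists (limn (power_series d z)) => /=.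
pose L := limn (series (fun n => `|b n| * rho ^+ n)).
have L0 : 0 <= L.
  apply: limr_ge => //; apply: nearW => n; rewrite /series/= sumr_ge0// => i _.
  by rewrite mulr_ge0// exprn_ge0// ltW.
have key (h : R[i]) : h != 0 -> modulus (z + h) < rho ->
   modulus (power_series_sum c (z + h) - power_series_sum c z
      - h * limn (power_series d z)) <= L * modulus h ^+ 2 / rho ^+ 2.
  move=> h0 zh.
  have zh1 : unit_disk (z + h) by exact: lt_trans zh r1.
  have c1 := power_series_cvg H zh1; have c2 := power_series_cvg H z1.
  (* The partial sums of [c] have one term more than those of the derived series: the constant terms
     cancel, and the term [k + 1] of [c] is matched with the term [k] of [d]. *)
  pose F n := power_series c (z + h) n.+1 - power_series c z n.+1
       - h * power_series d z n.
  have FL : F @ \oo --> power_series_sum c (z + h) - power_series_sum c z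
      - h * limn (power_series d z).
    have h1 : (fun n => power_series c (z + h) n.+1) @ \oo --> power_series_sum c (z + h).
      by rewrite (cvg_shiftS (power_series c (z + h))); exact: c1.
    have h2 : (fun n => power_series c z n.+1) @ \oo --> power_series_sum c z.
      by rewrite (cvg_shiftS (power_series c z)); exact: c2.
    have h3 : (fun n => h * power_series d z n) @ \oo --> h * limn (power_series d z).
      exact: (cvgM (cvg_cst h) cd).
    exact: (cvgB (cvgB h1 h2) h3).
  rewrite -(cvg_lim _ FL)//; apply: modulus_lim_le.
    by apply/cvg_ex; eexists; exact: FL.
  apply: nearW => n; rewrite /F.
  have -> : power_series c (z + h) n.+1 - power_series c z n.+1
       - h * power_series d z n =
     \sum_(0 <= k < n) c k.+1 * ((z + h) ^+ k.+1 - z ^+ k.+1 - k.+1%:R * z ^+ k * h).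
    rewrite /power_series /series/= !big_nat_recl//= !expr0 mulr_sumr.
    rewrite opprD addrACA subrr add0r -!sumrB; apply: eq_bigr => k _.
    by rewrite /d; ring.
  apply: le_trans (modulus_sum _ _ _) _.
  rewrite ler_pdivlMr ?exprn_gt0//.
  apply: le_trans (_ : series (fun n => `|b n| * rho ^+ n) n.+1 * modulus h ^+ 2 <= _).
    rewrite /series /= big_nat_recl// mulrDl.
    apply: ler_wpDl; first by rewrite !mulr_ge0 ?exprn_ge0 ?modulus_ge0// ltW.
    rewrite !mulr_suml; apply: ler_sum_nat => k _.
    rewrite modulusM expr2 mulrA -[X in X * rho]mulrA.
    have := expr_taylor2 k (ltW rz) (ltW zh).
    move=> /(ler_wpM2l (modulus_ge0 (c k.+1))) /(ler_wpM2r (ltW r0))/le_trans; apply.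
    rewrite /b ger0_norm ?mulr_ge0 ?modulus_ge0// (exprS rho).
    have -> : modulus (c k.+1) * (k.+1%:R ^+ 2 * rho ^+ k * modulus h ^+ 2) * rho =
      k.+1%:R ^+ 2 * (modulus (c k.+1) * (rho * rho ^+ k) * modulus h ^+ 2) by ring.
    have -> : k.+2%:R * (k.+2%:R * modulus (c k.+1)) * (rho * rho ^+ k) * modulus h ^+ 2 =
      k.+2%:R ^+ 2 * (modulus (c k.+1) * (rho * rho ^+ k) * modulus h ^+ 2) by ring.
    apply: ler_wpM2r; last by rewrite lerXn2r ?nnegrE// ler_nat.
    have rk : 0 <= rho ^+ k by rewrite exprn_ge0// ltW.
    apply: mulr_ge0; last by rewrite exprn_ge0 ?modulus_ge0.
    apply: mulr_ge0; first exact: modulus_ge0.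
    by apply: mulr_ge0; rewrite // ltW.
  rewrite ler_wpM2r ?exprn_ge0 ?modulus_ge0//.
  apply: nondecreasing_cvgn_le => //; apply/nondecreasing_series => k _ _.
  by apply: mulr_ge0 => //; rewrite exprn_ge0 // ltW.
apply/cvg_modulusP => e e0.
have small (t : R) : 0 < t -> \forall h \near (0 : R[i])^', modulus h < t.
  move=> t0; have t0' : 0 < t%:C by rewrite ltcR.
  have := @dnbhs0_lt _ R[i]^o _ t0'.
  by apply: filterS => y; rewrite modulus_norm ltcR.
have L1 : 0 < L + 1 by rewrite ltr_wpDl.
near=> h.
have h0 : h != 0 by near: h; exact: nbhs_dnbhs_neq.
have mh0 : 0 < modulus h.
  rewrite lt_neqAle modulus_ge0 andbT eq_sym; apply/eqP => /ComplexField.Normc.eq0_normc.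
  by move=> hh; rewrite hh eqxx in h0.
have hr : modulus h < rho - modulus z by near: h; apply: small; rewrite subr_gt0.
have he : modulus h < e * rho ^+ 2 / (L + 1).
  by near: h; apply: small; apply: divr_gt0 => //; exact: mulr_gt0 e0 (exprn_gt0 2 r0).
have zh : modulus (z + h) < rho.
  by apply: le_lt_trans (ler_modulusD _ _) _; rewrite -ltrBrDl.
rewrite modulusB.
have -> : h^-1 *: (power_series_sum c (h *: 1 + z) - power_series_sum c z) -
     limn (power_series d z) = h^-1 * (power_series_sum c (z + h) - power_series_sum c z
      - h * limn (power_series d z)).
  change (h^-1 * (power_series_sum c (h * 1 + z) - power_series_sum c z) -
    limn (power_series d z) = h^-1 * (power_series_sum c (z + h) - power_series_sum c z
      - h * limn (power_series d z))).
  by rewrite mulr1 (addrC h z) [RHS]mulrBr mulKf.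
rewrite modulusM modulusV mulrC ltr_pdivrMr//.
apply: le_lt_trans (key _ h0 zh) _.
rewrite ltr_pdivrMr ?exprn_gt0// expr2 mulrA -mulrA [ltRHS]mulrAC mulrA ltr_pM2r//.
move: he; rewrite ltr_pdivlMr ?ltr_wpDl// => he.
apply: le_lt_trans he; rewrite mulrC ler_wpM2l ?modulus_ge0// lerDl//.
Unshelve. all: end_near. Qed.

(** * Independence and subgaussian sums *)

Section integral_product.
Import HBNNSimple.
Local Open Scope ereal_scope.

(** Here [c] plays the role of the expectation of [W]: a product rule known for indicators of [Y]
    passes to simple functions by linearity and to nonnegative measurable functions by monotone
    convergence. *)
Lemma ge0_integral_mul_comp (d d' : measure_display) (T : measurableType d)
    (T' : measurableType d') (R : realType) (P : {measure set T -> \bar R})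
    (W : T -> R) (Y : T -> T') (c : R) (phi : T' -> \bar R) :
  measurable_fun [set: T] W -> (forall x, 0 <= W x)%R ->
  measurable_fun [set: T] Y -> (0 <= c)%R ->
  (forall B, measurable B ->
    \int[P]_x ((W x)%:E * (\1_B (Y x))%:E) = c%:E * P (Y @^-1` B)) ->
  measurable_fun [set: T'] phi -> (forall y, 0 <= phi y) ->
  \int[P]_x ((W x)%:E * phi (Y x)) = c%:E * \int[P]_x phi (Y x).
Proof.
move=> mW' W0 mY c0 H mphi phi0.
have mW : measurable_fun [set: T] (fun x => (W x)%:E) by exact/measurable_EFinP.
have mI (B : set T') : measurable B -> measurable_fun [set: T] (fun x => (\1_B (Y x) : R)%:E).
  move=> mB; apply: measurableT_comp => //.
  by apply: (measurableT_comp _ mY); exact: measurable_indic.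
have intI (B : set T') : measurable B -> \int[P]_x (\1_B (Y x))%:E = P (Y @^-1` B).
  move=> mB.
  have mYB : measurable (Y @^-1` B) by rewrite -[X in measurable X]setTI; exact: mY.
  by rewrite -[in RHS](setIT (Y @^-1` B)) -integral_indic.
have sfun_case (g : {nnsfun T' >-> R}) :
    \int[P]_x ((W x)%:E * (g (Y x))%:E) = c%:E * \int[P]_x (g (Y x))%:E.
  have gE x : (g (Y x))%:E =
      \sum_(y \in range g) (y%:E * (\1_(g @^-1` [set y]) (Y x))%:E).
    by rewrite fimfunE -fsumEFin.
  have mB y : measurable (g @^-1` [set y]) by [].
  have pos (y : R) x : 0 <= y%:E * (\1_(g @^-1` [set y]) (Y x))%:E.
    by rewrite -EFinM lee_fin; exact: nnfun_muleindic_ge0.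
  have pos' (y : R) x : 0 <= y%:E * ((W x)%:E * (\1_(g @^-1` [set y]) (Y x))%:E).
    by rewrite muleCA; apply: mule_ge0 => //; rewrite lee_fin.
  have mm y : measurable_fun [set: T]
      (fun x => y%:E * (\1_(g @^-1` [set y]) (Y x))%:E).
    exact: measurable_funeM (mI _ (mB y)).
  have mm' y : measurable_fun [set: T]
      (fun x => y%:E * ((W x)%:E * (\1_(g @^-1` [set y]) (Y x))%:E)).
    exact: measurable_funeM (emeasurable_funM mW (mI _ (mB y))).
  transitivity (\int[P]_x \sum_(y \in range g)
      (y%:E * ((W x)%:E * (\1_(g @^-1` [set y]) (Y x))%:E))).
    apply: eq_integral => x _; rewrite gE ge0_mule_fsumr//.
    by apply: eq_fsbigr => y _; rewrite muleCA.
  rewrite (ge0_integral_fsum _ measurableT mm')//.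
  transitivity (c%:E * \int[P]_x \sum_(y \in range g)
      (y%:E * (\1_(g @^-1` [set y]) (Y x))%:E)); last first.
    by congr (_ * _); apply: eq_integral => x _; rewrite -gE.
  rewrite (ge0_integral_fsum _ measurableT mm)// ge0_mule_fsumr; last first.
    by move=> y; apply: integral_ge0 => x _.
  apply: eq_fsbigr => y /[!inE] -[z _ gz].
  have y0 : (0 <= y)%R by rewrite -gz.
  rewrite !ge0_integralZl//; first by rewrite H// intI// muleCA.
  - exact: mI.
  - exact: emeasurable_funM mW (mI _ (mB y)).
  - by move=> x _; rewrite mule_ge0// lee_fin.
pose g := nnsfun_approx measurableT mphi.
have mg n : measurable_fun [set: T] (fun x => (g n (Y x))%:E).
  by apply: measurableT_comp => //; exact: measurableT_comp.
have ndg x : {homo (fun n => (g n (Y x))%:E) : n m / (n <= m)%N >-> n <= m}.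
  by move=> a b ab; rewrite lee_fin; exact/lefP/nd_nnsfun_approx.
have cg x : (g n (Y x))%:E @[n --> \oo] --> phi (Y x).
  exact: cvg_nnsfun_approx.
have L1 : \int[P]_x ((W x)%:E * (g n (Y x))%:E) @[n --> \oo] -->
    \int[P]_x ((W x)%:E * phi (Y x)).
  rewrite (_ : (fun x => (W x)%:E * phi (Y x)) =
    fun x => limn (fun n => (W x)%:E * (g n (Y x))%:E)).
    apply: cvg_monotone_convergence => //.
    - by move=> n; exact: emeasurable_funM.
    - by move=> n x _; rewrite mule_ge0// lee_fin.
    - by move=> x _ a b ab; apply: lee_wpmul2l; [rewrite lee_fin|exact: ndg].
  apply/funext => x; apply/esym/cvg_lim => //.
  exact: cvgeZl (cg x).
have L2 : \int[P]_x (g n (Y x))%:E @[n --> \oo] --> \int[P]_x (phi (Y x)).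
  rewrite (_ : (fun x => phi (Y x)) = fun x => limn (fun n => (g n (Y x))%:E)).
    apply: cvg_monotone_convergence => //.
    by move=> n x _; rewrite lee_fin.
  by apply/funext => x; exact/esym/cvg_lim.
have L3 : c%:E * \int[P]_x (g n (Y x))%:E @[n --> \oo] --> c%:E * \int[P]_x (phi (Y x)).
  exact: cvgeZl L2.
rewrite -(cvg_lim _ L1)// -(cvg_lim _ L3)//.
by congr (limn _); apply/funext => n; exact: sfun_case.
Qed.

End integral_product.

Section independence.

Lemma prod_indic (T : Type) (R : realType) (A : nat -> set T) n x :
  \prod_(0 <= k < n) (\1_(A k) x : R) = \1_(\bigcap_(k in `I_n) A k) x.
Proof.
elim: n => [|n IH].
  by rewrite big_nil indicE mem_set// => k.
rewrite big_nat_recr//= IH !indicE -natrM mulnb -in_setI; congr ((_ \in _)%:R).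
apply/seteqP; split => [t [h1 h2] k /=|t h].
  by rewrite ltnS leq_eqVlt => /orP[/eqP->//|]; exact: h1.
by split; [move=> k /= kn; apply: h => /=; exact: ltnW|exact: h (ltnSn n)].
Qed.

Lemma integral_prod_indic (d d' : measure_display) (T : measurableType d)
    (T' : measurableType d') (R : realType) (P : probability T R)
    (Y : nat -> T -> T') (B : nat -> set T') n :
  (forall k, measurable_fun [set: T] (Y k)) -> (forall k, measurable (B k)) ->
  (\int[P]_x (\prod_(0 <= k < n) (\1_(B k) (Y k x)))%:E =
   P (\bigcap_(k in `I_n) (Y k @^-1` B k)))%E.
Proof.
move=> mY mB.
have mI : measurable (\bigcap_(k in `I_n) (Y k @^-1` B k)).
  apply: bigcap_measurableType => k _.
  by rewrite -[X in measurable X]setTI; exact: mY.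
rewrite -[in RHS](setIT (\bigcap_(k in _) _)) -integral_indic//.
apply: eq_integral => x _; congr EFin.
by rewrite -prod_indic; apply: eq_bigr => k _.
Qed.

(** The induction needs a mixed statement: the indices below [n] carry the functions [phi], the next
    [m] carry arbitrary indicators. For [n = 0] this is independence itself, and each step replaces
    the indicator at the index [n] by [phi n]. Independence of whole blocks of variables is thereby
    avoided. *)
Lemma integral_prod_independent (d d' : measure_display) (T : measurableType d)
    (T' : measurableType d') (R : realType) (P : probability T R)
    (Y : nat -> T -> T') (phi : nat -> T' -> R) (e : nat -> R) :
  (forall k, measurable_fun [set: T] (Y k)) ->
  (forall n (B : nat -> set T'), (forall k, measurable (B k)) ->
    P (\bigcap_(k in `I_n) (Y k @^-1` B k)) =
    (\prod_(0 <= k < n) P (Y k @^-1` B k))%E) ->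
  (forall k, measurable_fun [set: T'] (phi k)) ->
  (forall k y, 0 <= phi k y) ->
  (forall k, \int[P]_x (phi k (Y k x))%:E = (e k)%:E)%E ->
  forall n, (\int[P]_x (\prod_(0 <= k < n) phi k (Y k x))%:E =
    (\prod_(0 <= k < n) e k)%:E)%E.
Proof.
move=> mY indep mphi phi0 He n.
have e0 k : 0 <= e k.
  by rewrite -lee_fin -He; apply: integral_ge0 => x _; rewrite lee_fin.
pose p (B : nat -> set T') k := fine (P (Y k @^-1` B k)).
have p0 B k : 0 <= p B k by rewrite /p fine_ge0.
suff H m (B : nat -> set T') : (forall k, measurable (B k)) ->
   (\int[P]_x (\prod_(0 <= k < n) phi k (Y k x) *
      \prod_(n <= k < n + m) \1_(B k) (Y k x))%:E =
    (\prod_(0 <= k < n) e k * \prod_(n <= k < n + m) p B k)%:E)%E.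
  have := H 0%N (fun=> setT) (fun=> measurableT).
  rewrite addn0 (big_geq (leqnn n)) mulr1 => <-.
  by apply: eq_integral => x _; rewrite (big_geq (leqnn n)) mulr1.
elim: n m B => [|n IH] m B mB.
  rewrite big_nil mul1r add0n.
  transitivity (\int[P]_x (\prod_(0 <= k < m) (\1_(B k) (Y k x)))%:E)%E.
    by apply: eq_integral => x _; rewrite big_nil mul1r.
  rewrite integral_prod_indic// indep//.
  elim: m => [|m IH]; first by rewrite !big_nil.
  by rewrite !big_nat_recr//= IH EFinM /p fineK// fin_num_measure//
    -[X in measurable X]setTI; exact: mY.
pose W x := \prod_(0 <= k < n) phi k (Y k x) *
   \prod_(n.+1 <= k < n.+1 + m) (\1_(B k) (Y k x) : R).
pose c := \prod_(0 <= k < n) e k * \prod_(n.+1 <= k < n.+1 + m) p B k.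
transitivity (\int[P]_x ((W x)%:E * (phi n (Y n x))%:E))%E.
  apply: eq_integral => x _; rewrite -EFinM /W big_nat_recr//=; congr EFin.
  by rewrite mulrAC.
have -> : \prod_(0 <= k < n.+1) e k * \prod_(n.+1 <= k < n.+1 + m) p B k = c * e n.
  by rewrite /c big_nat_recr//= mulrAC.
rewrite EFinM -He.
apply: (@ge0_integral_mul_comp _ _ _ _ _ P W (Y n) c (EFin \o phi n)) => //.
- apply: measurable_funM; apply: measurable_prod => k _.
    exact: measurableT_comp.
  by apply: (measurableT_comp _ (mY k)); exact: measurable_indic.
- move=> x; rewrite mulr_ge0// big_nat prodr_ge0//.
- by rewrite mulr_ge0// prodr_ge0.
(* Inserting [C] as an additional indicator at the index [n] turns the induction hypothesis, for
   [m + 1] indicators, into the product rule for indicators of [Y n]. *)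
- move=> C mC; pose B' k := if k == n then C else B k.
  have mB' k : measurable (B' k) by rewrite /B'; case: ifP.
  have := IH m.+1 B' mB'.
  have E (F : nat -> set T' -> R) : \prod_(n <= k < n + m.+1) F k (B' k) =
     F n C * \prod_(n.+1 <= k < n.+1 + m) F k (B k).
    rewrite big_ltn ?addnS ?ltnS ?leq_addr// addSn /B' eqxx; congr (_ * _).
    by apply: eq_big_nat => k /andP[nk _]; rewrite gtn_eqF.
  rewrite (E (fun k C => fine (P (Y k @^-1` C)))) mulrCA -/c => H.
  transitivity (\int[P]_x ((\prod_(0 <= k < n) phi k (Y k x) *
          \prod_(n <= k < n + m.+1) \1_(B' k) (Y k x))%:E))%E.
    apply: eq_integral => x _; rewrite -EFinM; congr EFin.
    by rewrite (E (fun k C => \1_C (Y k x))) /W -mulrA [X in _ = _ * X]mulrC.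
  rewrite H mulrC EFinM fineK// fin_num_measure// -[X in measurable X]setTI; exact: mY.
- exact/measurable_EFinP.
- by move=> y; rewrite /= lee_fin.
Qed.

End independence.

(** * Exponential moments of one subgaussian variable *)

Section moment_generating_function.
Context (d : measure_display) (T : measurableType d) (R : realType).
Context (P : probability T R).

(** The linear term has zero mean for a centred variable, which leaves an exponential of a square.
    For [x >= 1/2] use [x <= 2 x^2]; for [x < 1/2] use [exp x <= 1/(1-x) <= 1 + x + 2 x^2]. *)
Lemma expR_le_add_expR_sqr (x : R) : expR x <= x + expR (2 * x ^+ 2).
Proof.
have h2 := expR_ge1Dx (2 * x ^+ 2).
case: (leP (1 / 2) x) => [x12|x12].
  have : expR x <= expR (2 * x ^+ 2) by rewrite ler_expR; nra.
  move=> h; lra.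
have x1 : 0 < 1 - x by lra.
have h : expR x * (1 - x) <= 1.
  by have := ler_wpM2l (ltW (expR_gt0 x)) (expR_ge1Dx (- x)); rewrite expRxMexpNx_1.
have {h} : expR x <= (1 - x)^-1 by rewrite -[leRHS]mul1r ler_pdivlMr.
move=> /le_trans; apply; rewrite -[leLHS]mul1r ler_pdivrMr//.
have H : 1 <= (1 + x + 2 * x ^+ 2) * (1 - x).
  have -> : (1 + x + 2 * x ^+ 2) * (1 - x) = 1 + x ^+ 2 * (1 - 2 * x) by ring.
  rewrite lerDl mulr_ge0 ?sqr_ge0//; lra.
apply: le_trans H _; apply: ler_wpM2r; [exact: ltW|lra].
Qed.

(** Convexity of the exponential on the segment from 0 to [v], obtained from the tangent at [t v]
    evaluated at both ends. *)
Lemma expR_convex1 (t v : R) : 0 <= t <= 1 ->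
  expR (t * v) <= 1 - t + t * expR v.
Proof.
move=> /andP[t0 t1].
have E1 : expR v = expR (t * v) * expR ((1 - t) * v) by rewrite -expRD; congr expR; ring.
have E2 : 1 = expR (t * v) * expR (- (t * v)) by rewrite expRxMexpNx_1.
have p := expR_gt0 (t * v).
have h1 : expR (t * v) * (1 + (1 - t) * v) <= expR v.
  by rewrite E1 ler_wpM2l ?(ltW p)// expR_ge1Dx.
have h2 : expR (t * v) * (1 - t * v) <= 1.
  by rewrite [leRHS]E2 ler_wpM2l ?(ltW p)// expR_ge1Dx.
have := ler_wpM2l t0 h1.
have t1' : 0 <= 1 - t by rewrite subr_ge0.
have := ler_wpM2l t1' h2.
move: (expR (t * v)) (expR v) => a b H1 H2.
have -> : a = (1 - t) * (a * (1 - t * v)) + t * (a * (1 + (1 - t) * v)) by ring.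
lra.
Qed.

Lemma nneseries_geometric_le (a q : R) : 0 <= a -> 0 <= q < 1 ->
  (\sum_(k <oo) (a * q ^+ k)%:E <= (a / (1 - q))%:E)%E.
Proof.
move=> a0 /andP[q0 q1].
apply: lime_le.
  by apply: is_cvg_nneseries => k _ _; rewrite lee_fin mulr_ge0 ?exprn_ge0.
apply: nearW => n; rewrite sumEFin lee_fin.
have -> : \sum_(0 <= k < n) a * q ^+ k = a * ((1 - q ^+ n) / (1 - q)).
  rewrite -mulr_sumr; congr (_ * _).
  have q1' : 1 - q != 0 by rewrite gt_eqF// subr_gt0.
  apply: (mulIf q1'); rewrite divfK// big_mkord mulrC -opprB mulNr -subrX1.
  by rewrite opprB.
apply: ler_wpM2l => //; rewrite -[leRHS]mul1r.
apply: ler_wpM2r; first by rewrite invr_ge0 subr_ge0 (ltW q1).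
by rewrite lerBlDr lerDl exprn_ge0.
Qed.

Lemma measurable_Re_mul (Y : T -> R[i]) (c : R[i]) : complex_random_variable Y ->
  measurable_fun [set: T] (fun w => complex.Re (c * Y w)).
Proof.
move=> mY.
have m1 : measurable_fun [set: T] (fun w => complex.Re (Y w)).
  by apply: (measurableT_comp measurable_fst mY).
have m2 : measurable_fun [set: T] (fun w => complex.Im (Y w)).
  by apply: (measurableT_comp measurable_snd mY).
rewrite (_ : (fun w => _) = (fun w => complex.Re c * complex.Re (Y w) -
   complex.Im c * complex.Im (Y w))).
  by apply: measurable_funB; exact: measurable_funM.
by apply/funext => w; case: c => ? ?; case: (Y w).
Qed.

Lemma measurable_modulus (Y : T -> R[i]) : complex_random_variable Y ->
  measurable_fun [set: T] (fun w => modulus (Y w)).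
Proof.
move=> mY.
have m1 : measurable_fun [set: T] (fun w => complex.Re (Y w)).
  by apply: (measurableT_comp measurable_fst mY).
have m2 : measurable_fun [set: T] (fun w => complex.Im (Y w)).
  by apply: (measurableT_comp measurable_snd mY).
rewrite (_ : (fun w => _) = (fun w =>
   (complex.Re (Y w) ^+ 2 + complex.Im (Y w) ^+ 2) `^ (2^-1))).
  apply: (measurableT_comp (measurable_powR 2^-1)).
  by apply: measurable_funD; exact: measurable_funX.
apply/funext => w; rewrite -sqr_modulus powR12_sqrt ?sqr_ge0//.
by rewrite sqrtr_sqr ger0_norm ?modulus_ge0.
Qed.

Lemma measurable_superlevel (f : T -> R) (t : R) :
  measurable_fun [set: T] f -> measurable [set w | t < f w].
Proof.
move=> mf; rewrite (_ : [set w | t < f w] = setT `&` f @^-1` `]t, +oo[%classic).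
  by apply: mf.
by rewrite setTI; apply/seteqP; split=> w /=; rewrite in_itv/= andbT.
Qed.

(** This is [1] plus the sum over [k] of [exp (k+1) * K exp (-2k)]. With [V = |Y|^2 / (2 tau^2)] the
    subgaussian tail gives [P(V > k) <= K exp (-2k)]; the [2] in the denominator of [V] is what
    makes the series converge. *)
Definition subgaussian_moment (K : R) : R := 1 + K * expR 1 / (1 - expR (- 1)).

Lemma subgaussian_moment_ge1 (K : R) : 0 <= K -> 1 <= subgaussian_moment K.
Proof.
move=> K0; rewrite /subgaussian_moment lerDl; apply: divr_ge0.
  by rewrite mulr_ge0 ?expR_ge0.
by rewrite subr_ge0 -[leRHS]expR0 ler_expR lerN10.
Qed.

Section one_variable.
Variables (Y : T -> R[i]) (K tau : R).
Hypothesis mY : complex_random_variable Y.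
Hypothesis K0 : 0 < K.
Hypothesis tau0 : 0 < tau.
Hypothesis hY : subgaussian_with P K tau Y.

Let V w := modulus (Y w) ^+ 2 / (2 * tau ^+ 2).
Let M := subgaussian_moment K.

Let V0 w : 0 <= V w.
Proof. by apply: divr_ge0; [|apply: mulr_ge0 => //]; exact: sqr_ge0. Qed.

Let mV : measurable_fun [set: T] V.
Proof. by apply: measurable_funM => //; apply: measurable_funX; exact: measurable_modulus. Qed.

Let mexpV (f : T -> R) : measurable_fun [set: T] f ->
  measurable_fun [set: T] (fun w => (expR (f w))%:E).
Proof. by move=> mf; apply/measurable_EFinP; apply: measurableT_comp mf. Qed.

(** Discrete layer-cake estimate: if [k < V <= k + 1], then [exp V] is at most [exp (k+1)] times the
    indicator of [V > k]; the case [V = 0] is covered by the summand 1. *)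
Lemma subgaussian_exp_sqr_moment :
  (\int[P]_w (expR (modulus (Y w) ^+ 2 / (2 * tau ^+ 2)))%:E <=
   (subgaussian_moment K)%:E)%E.
Proof.
pose A k := [set w | k%:R < V w].
have mA k : measurable (A k).
  exact: measurable_superlevel.
have PA k : (P (A k) <= (K * expR (- 1) ^+ k ^+ 2)%:E)%E.
  have t0 : 0 <= Num.sqrt (2 * k%:R) * tau by rewrite mulr_ge0 ?sqrtr_ge0 ?ltW.
  apply: le_trans (le_trans _ (hY t0)) _.
    rewrite le_measure ?inE//.
      exact: measurable_superlevel (measurable_modulus mY).
    move=> w; rewrite /A /V/= ltr_pdivlMr; last by rewrite mulr_gt0 ?exprn_gt0.
    move=> h; rewrite -(@ltr_pXn2r _ 2) ?nnegrE ?modulus_ge0//.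
    rewrite exprMn sqr_sqrtr ?mulr_ge0//.
    by have -> : 2 * k%:R * tau ^+ 2 = k%:R * (2 * tau ^+ 2) by ring.
  rewrite lee_fin ler_wpM2l ?(ltW K0)// exprMn sqr_sqrtr ?mulr_ge0//.
  rewrite mulfK ?expf_neq0 ?gt_eqF// -exprM -expRM_natr ler_expR.
  by rewrite natrM mulN1r mulrC.
pose h k w : \bar R := ((expR k.+1%:R)%:E * (\1_(A k) w : R)%:E)%E.
have pos k w : (0 <= h k w)%E.
  by rewrite /h -EFinM lee_fin mulr_ge0// expR_ge0.
have eV w : ((expR (V w))%:E <=
    1 + \sum_(k <oo) h k w)%E.
  have [V0'|Vpos] := leP (V w) 0.
    have -> : V w = 0 by apply/eqP; rewrite eq_le V0' V0.
    by rewrite expR0 leeDl//; apply: nneseries_ge0.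
  pose n := Num.truncn (V w).
  have [n1 n2] : n%:R <= V w /\ V w < n.+1%:R.
    by have /andP[] := truncn_itv (V0 w).
  (* The sets [A k] are strict superlevel sets, so the interval must be open on the left: truncation
     is lowered by one when [V w] is an integer. *)
  have [k [k1 k2]] : exists k : nat, k%:R < V w /\ V w <= k.+1%:R.
    have [nV|nV] := ltP n%:R (V w); first by exists n; split => //; exact: ltW.
    have E : V w = n%:R by apply/eqP; rewrite eq_le nV n1.
    have n0 : (0 < n)%N by rewrite -(ltr_nat R) -E.
    by exists n.-1; rewrite E ltr_nat ler_nat prednK// leqnn.
  apply: le_trans (_ : (h k w <= _)%E).
    by rewrite /h indicE mem_set// mule1 lee_fin ler_expR.
  rewrite -[leLHS]add0e leeD//.
  apply: le_trans (@nneseries_lim_ge _ _ xpredT 0 k.+1 _) => //.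
  by rewrite big_nat_recr//= leeDr// sume_ge0.
have mm k : measurable_fun [set: T] (h k).
  by apply/measurable_EFinP; apply: measurable_funM.
have mser : measurable_fun [set: T]
    (fun w => \sum_(k <oo) h k w)%E.
  by apply: ge0_emeasurable_sum => // k *; exact: mm.
apply: (@le_trans _ _ (\int[P]_w (1 + \sum_(k <oo) h k w))%E).
  apply: ge0_le_integral => //.
  - exact: mexpV.
  - exact: emeasurable_funD.
  - by move=> w _; exact: eV.
rewrite ge0_integralD//; last by move=> w _; apply: nneseries_ge0.

rewrite integral_cst// [X in (1 * X)%E](_ : _ = 1%E); last exact: probability_setT.
rewrite mule1 /subgaussian_moment EFinD leeD//.
rewrite integral_nneseries//.
have q01 : 0 <= expR (- 1 : R) < 1.
  by rewrite expR_ge0/= -[ltRHS]expR0 ltr_expR ltrN10.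
have a0 : 0 <= K * expR 1 by rewrite mulr_ge0 ?expR_ge0 ?ltW.
apply: le_trans _ (nneseries_geometric_le a0 q01).
apply: lee_nneseries => k _.
  by move=> _; apply: integral_ge0.
rewrite /h ge0_integralZl// ?integral_indic ?setIT//.
have e0 : (0 <= (expR k.+1%:R : R)%:E)%E by rewrite lee_fin expR_ge0.
apply: le_trans (lee_wpmul2l e0 (PA k)) _.
rewrite -EFinM lee_fin -exprM -!expRM_natr mulrCA -[leRHS]mulrA.
by rewrite ler_wpM2l ?(ltW K0)// -!expRD ler_expR -natr1 natrM; lra.
by apply/measurable_EFinP; exact: measurable_indic.
Qed.

Let intV_lty : (\int[P]_w (expR (V w))%:E < +oo)%E.
Proof. exact: le_lt_trans subgaussian_exp_sqr_moment (ltry _). Qed.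

(** Follows from [V <= exp V]. The bound is uniform along the sequence, so the squares [|X_n|^2] are
    summable against any summable weights. *)
Lemma subgaussian_sqr_moment :
  (\int[P]_w (modulus (Y w) ^+ 2)%:E <= (2 * tau ^+ 2 * subgaussian_moment K)%:E)%E.
Proof.
have t0 : 0 < 2 * tau ^+ 2 by rewrite mulr_gt0 ?exprn_gt0.
apply: (@le_trans _ _ (\int[P]_w ((2 * tau ^+ 2)%:E * (expR (V w))%:E))%E).
  apply: ge0_le_integral => //.
  - by move=> w _; rewrite lee_fin sqr_ge0.
  - by apply/measurable_EFinP; apply: measurable_funX; exact: measurable_modulus.
  - by apply: measurable_funeM; exact: mexpV.
  - move=> w _; rewrite -EFinM lee_fin mulrC -ler_pdivrMr//.
    by apply: le_trans (expR_ge1Dx _); rewrite lerDr.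
rewrite ge0_integralZl//.
- rewrite [leRHS]EFinM; apply: lee_wpmul2l; first by rewrite lee_fin ltW.
  exact: subgaussian_exp_sqr_moment.
- exact: mexpV.
- by rewrite lee_fin ltW.
Qed.

Let integrable_expV : P.-integrable [set: T] (fun w => (expR (V w))%:E).
Proof.
apply/integrableP; split; first exact: mexpV.
by under eq_integral do rewrite gee0_abs ?lee_fin ?expR_ge0//.
Qed.

Let integrable_part (g : R[i] -> R) : (forall z, `|g z| <= modulus z) ->
  measurable_fun [set: T] (fun w => g (Y w)) ->
  P.-integrable [set: T] (fun w => (g (Y w))%:E).
Proof.
move=> gm mg.
have t0 : 0 < 2 * tau ^+ 2 by rewrite mulr_gt0 ?exprn_gt0.
have : P.-integrable [set: T] (fun w => (1 + 2 * tau ^+ 2)%:E * (expR (V w))%:E)%E.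
  exact: integrableZl.
apply: le_integrable => //; first exact/measurable_EFinP.
move=> w _; rewrite -EFinM !abse_EFin lee_fin [leRHS]ger0_norm; last first.
  by apply: mulr_ge0; [apply: addr_ge0 => //; exact: ltW|exact: expR_ge0].
apply: le_trans (gm _) _.
have E : modulus (Y w) ^+ 2 = 2 * tau ^+ 2 * V w by rewrite /V mulrC divfK ?gt_eqF.
have h1 : modulus (Y w) <= 1 + modulus (Y w) ^+ 2.
  by have := sqr_ge0 (modulus (Y w) - 1 / 2); nra.
have h2 := ler_wpM2l (ltW t0) (expR_ge1Dx (V w)); have h3 := expR_ge1Dx (V w).
by have := V0 w; move: (expR (V w)) h2 h3 => a; lra.
Qed.

(** The bound tends to 1 as [c] tends to 0, so for small [c] centring must be used. With
    [th = 4 tau^2 |c|^2] one has [2 (|c| |Y|)^2 = th V]. For [th <= 1] the two exponential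
    inequalities give [exp x <= x + 1 - th + th exp V] for [x = Re (c Y)], whose mean is at most
    [1 + th M <= exp (th M)]. *)
Lemma subgaussian_mgf (c : R[i]) : centred P Y ->
  (\int[P]_w (expR (complex.Re (c * Y w)))%:E <=
   (expR (4 * tau ^+ 2 * subgaussian_moment K * modulus c ^+ 2))%:E)%E.
Proof.
move=> [cR cI].
have t0 : 0 < 2 * tau ^+ 2 by rewrite mulr_gt0 ?exprn_gt0.
have M1 : 1 <= M by apply: subgaussian_moment_ge1; exact: ltW.
pose th := 4 * tau ^+ 2 * modulus c ^+ 2.
have th0 : 0 <= th by apply: mulr_ge0; [apply: mulr_ge0 => //|]; exact: sqr_ge0.
have -> : 4 * tau ^+ 2 * subgaussian_moment K * modulus c ^+ 2 = th * M.
  by rewrite /th mulrAC.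
have E w : 2 * (modulus c * modulus (Y w)) ^+ 2 = th * V w.
  rewrite /th /V exprMn; field; rewrite gt_eqF//.
have mRe := measurable_Re_mul c mY.
have [th1|th1] := leP th 1.
  have Re0 : (\int[P]_w (complex.Re (c * Y w))%:E = 0)%E.
    have m1 : measurable_fun [set: T] (fun w => complex.Re (Y w)).
      by apply: (measurableT_comp measurable_fst mY).
    have m2 : measurable_fun [set: T] (fun w => complex.Im (Y w)).
      by apply: (measurableT_comp measurable_snd mY).
    have i1 := integrable_part (@norm_Re_modulus R) m1.
    have i2 := integrable_part (@norm_Im_modulus R) m2.
    move: cR cI; rewrite unlock => cR cI.
    transitivity (\int[P]_w ((complex.Re c)%:E * (complex.Re (Y w))%:E +
        (- complex.Im c)%:E * (complex.Im (Y w))%:E))%E.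
      apply: eq_integral => w _; rewrite -!EFinM -EFinD mulNr; congr EFin.
      by case: c {th th0 E mRe th1} => ? ?; case: (Y w).
    rewrite integralD//; [|exact: integrableZl|exact: integrableZl].
    by rewrite !integralZl// cR cI !mule0 adde0.
  have iRe : P.-integrable [set: T] (fun w => (complex.Re (c * Y w))%:E).
    have : P.-integrable [set: T] (fun w => (1 + 2 * tau ^+ 2)%:E * (expR (V w))%:E)%E.
      exact: integrableZl.
    apply: le_integrable => //; first exact/measurable_EFinP.
    move=> w _; rewrite -EFinM !abse_EFin lee_fin [leRHS]ger0_norm; last first.
      by apply: mulr_ge0; [apply: addr_ge0 => //; exact: ltW|exact: expR_ge0].
    apply: le_trans (norm_Re_modulus _) _.
    rewrite modulusM.
    have p1 := expR_ge1Dx (V w).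
    have p2 : (modulus c * modulus (Y w)) ^+ 2 <= V w.
      by have := E w; have := V0 w; nra.
    have := sqr_ge0 (modulus c * modulus (Y w) - 1 / 2); have := V0 w.
    by nra.
  pose b w := 1 - th + th * expR (V w).
  have ib : P.-integrable [set: T] (fun w => (b w)%:E).
    have : P.-integrable [set: T] (fun w => (1 - th)%:E + th%:E * (expR (V w))%:E)%E.
      apply: integrableD => //; last exact: integrableZl.
      exact: finite_measure_integrable_cst.
    by [].
  have le_b w : expR (complex.Re (c * Y w)) <= complex.Re (c * Y w) + b w.
    apply: le_trans (expR_le_add_expR_sqr _) _.
    rewrite lerD2l; apply: le_trans (expR_convex1 _ _); last by rewrite th0 th1.
    rewrite ler_expR -E ler_wpM2l// -modulusM.
    by rewrite -[leLHS]real_normK ?num_real// lerXn2r ?nnegrE ?modulus_ge0// norm_Re_modulus.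
  apply: (@le_trans _ _ (\int[P]_w ((complex.Re (c * Y w))%:E + (b w)%:E))%E).
    apply: ge0_le_integral => //.
    - exact: mexpV.
    - by have /integrableP[] := integrableD measurableT iRe ib.
    - by move=> w _; rewrite -EFinD lee_fin.
  rewrite integralD// Re0 add0e.
  apply: (@le_trans _ _ ((1 - th)%:E + th%:E * \int[P]_w (expR (V w))%:E)%E).
    rewrite -integralZl//.
    rewrite (_ : (1 - th)%:E = \int[P]_(w in [set: T]) (cst (1 - th)%:E) w)%E.
      rewrite -integralD//; first exact: finite_measure_integrable_cst.
      exact: integrableZl.
    rewrite integral_cst// [X in (_ * X)%E](_ : _ = 1%E); last exact: probability_setT.
    by rewrite mule1.
  apply: (@le_trans _ _ ((1 - th)%:E + th%:E * M%:E)%E).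
    by rewrite leeD2l// lee_wpmul2l ?lee_fin//; exact: subgaussian_exp_sqr_moment.
  rewrite -EFinM -EFinD lee_fin; apply: le_trans (expR_ge1Dx _).
  by lra.
(* For [th > 1] centring plays no part: the inequality of the means gives [|c| |Y| <= th/4 + V], and
   the factor [M <= exp (M - 1)] is absorbed because [M - 1 <= th (M - 1)]. *)
have le_V w : expR (complex.Re (c * Y w)) <= expR (th / 4) * expR (V w).
  rewrite -expRD ler_expR.
  apply: le_trans (le_trans (ler_norm _) (norm_Re_modulus _)) _.
  rewrite modulusM.
  have := sqr_ge0 (2 * tau ^+ 2 * modulus c - modulus (Y w)).
  have : modulus (Y w) ^+ 2 = 2 * tau ^+ 2 * V w by rewrite /V mulrC divfK ?gt_eqF.
  rewrite sqrrB => -> H.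
  have {}H : 0 <= 2 * tau ^+ 2 * (2 * tau ^+ 2 * modulus c ^+ 2
     - 2 * (modulus c * modulus (Y w)) + V w).
    by apply: le_trans H _; rewrite le_eqVlt; apply/orP; left; apply/eqP; ring.
  rewrite pmulr_rge0// in H.
  by have := V0 w; rewrite /th; lra.
apply: (@le_trans _ _ (\int[P]_w ((expR (th / 4))%:E * (expR (V w))%:E))%E).
  apply: ge0_le_integral => //.
  - exact: mexpV.
  - by apply: measurable_funeM; exact: mexpV.
  - by move=> w _; rewrite -EFinM lee_fin.
rewrite ge0_integralZl//; last exact: mexpV.
apply: (@le_trans _ _ ((expR (th / 4))%:E * M%:E)%E).
  by rewrite lee_wpmul2l ?lee_fin ?expR_ge0//; exact: subgaussian_exp_sqr_moment.
rewrite -EFinM lee_fin.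
apply: (@le_trans _ _ (expR (th / 4) * expR (M - 1))).
  apply: ler_wpM2l; first exact: expR_ge0.
  by apply: le_trans (expR_ge1Dx _); rewrite addrC subrK.
by rewrite -expRD ler_expR; nra.
Qed.

End one_variable.
End moment_generating_function.

(** * Almost sure bounds for countable families of random sums *)

Section random_sums.
Context (d : measure_display) (T : measurableType d) (R : realType).
Context (P : probability T R).

(** By monotone convergence the full series has expectation at most [S], so it is finite almost
    surely and its value serves as [Z]. This takes the place of a Borel-Cantelli argument. *)
Lemma ae_bounded_sums (U : nat -> T -> R) (v : nat -> R) (S : R) :
  (forall k, measurable_fun [set: T] (U k)) -> (forall k w, 0 <= U k w) ->
  (forall k, \int[P]_w (U k w)%:E <= (v k)%:E)%E ->
  (forall n, \sum_(0 <= k < n) v k <= S) ->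
  {ae P, forall w, exists Z, forall n, \sum_(0 <= k < n) U k w <= Z}.
Proof.
move=> mU U0 Uv vS.
have EU0 k w : (0 <= (U k w)%:E)%E by rewrite lee_fin.
pose F w : \bar R := (\sum_(k <oo) (U k w)%:E)%E.
have F0 w : (0 <= F w)%E by apply: nneseries_ge0.
have mF : measurable_fun [set: T] F.
  by apply: ge0_emeasurable_sum => // k *; exact/measurable_EFinP.
have iF : P.-integrable [set: T] F.
  apply/integrableP; split => //.
  under eq_integral do rewrite gee0_abs//.
  rewrite integral_nneseries//; last by move=> k; exact/measurable_EFinP.
  apply: (@le_lt_trans _ _ S%:E); last exact: ltry.
  apply: lime_le; first by apply: is_cvg_nneseries => k _ _; exact: integral_ge0.
  apply: nearW => n; apply: (@le_trans _ _ (\sum_(0 <= k < n) (v k)%:E)%E).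
    by apply: lee_sum => k _.
  by rewrite sumEFin lee_fin.
have := integrable_ae measurableT iF.
apply: filterS => w /(_ I) Fw; exists (fine (F w)) => n.
rewrite -lee_fin fineK// -sumEFin.
exact: nneseries_lim_ge.
Qed.

Lemma sum_inv_sqr_le1 (n : nat) : \sum_(0 <= k < n) (k.+2%:R ^- 2 : R) <= 1.
Proof.
suff : \sum_(0 <= k < n) (k.+2%:R ^- 2 : R) <= 1 - n.+1%:R^-1.
  by move=> /le_trans; apply; rewrite lerBlDr lerDl invr_ge0.
elim: n => [|n IH]; first by rewrite big_nil invr1 subrr.
rewrite big_nat_recr//=; apply: le_trans (lerD IH (lexx _)) _.
have p1 : 0 < n.+1%:R :> R by [].
have E : n.+2%:R = n.+1%:R + 1 :> R by rewrite -natr1.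
rewrite E; move: (n.+1%:R : R) p1 => x x0.
have -> : 1 - x^-1 + (x + 1) ^- 2 = 1 - (x + 1)^-1 - (x * (x + 1) ^+ 2)^-1.
  by field; rewrite !gt_eqF// addr_gt0.
by rewrite lerBlDr lerDl invr_ge0 mulr_ge0 ?sqr_ge0 ?ltW.
Qed.

Section independent_subgaussian.
Variables (X : nat -> T -> R[i]) (K tau : R).
Hypothesis X_rv : forall n, complex_random_variable (X n).
Hypothesis X_independent : independent_sequence P X.
Hypothesis X_centred : forall n, centred P (X n).
Hypothesis K0 : 0 < K.
Hypothesis tau0 : 0 < tau.
Hypothesis X_subgaussian : forall n, subgaussian_with P K tau (X n).

Let kappa := 4 * tau ^+ 2 * subgaussian_moment K.

Let kappa_ge0 : 0 <= kappa.
Proof.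
have : 1 <= subgaussian_moment K by apply: subgaussian_moment_ge1; exact: ltW.
move=> h; apply: mulr_ge0; last by apply: le_trans h.
by apply: mulr_ge0 => //; exact: sqr_ge0.
Qed.

Lemma independent_initial n (B : nat -> set (R * R)) : (forall k, measurable (B k)) ->
  P (\bigcap_(k in `I_n) ((fun w => re_im (X k w)) @^-1` B k)) =
  (\prod_(0 <= k < n) P ((fun w => re_im (X k w)) @^-1` B k))%E.
Proof.
move=> mB; pose J := [fset k | k in iota 0 n]%fset.
have memJ k : (k \in J) = (k < n)%N.
  by rewrite /J !inE/= mem_iota.
have := @X_independent J B (fun k _ => mB k).
rewrite (_ : [set` J] = `I_n); last first.
  by apply/seteqP; split => k /=; rewrite memJ.
move=> ->; apply: perm_big.
apply: uniq_perm; [exact: fset_uniq|exact: iota_uniq|].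
by move=> k; rewrite memJ mem_index_iota.
Qed.

(** The exponential of the sum is a product of nonnegative functions of the independent pairs
    [re_im (X k w)], so its expectation is the product of the individual ones. *)
Lemma random_sum_mgf (c : nat -> R[i]) n :
  (\int[P]_w (expR (complex.Re (\sum_(0 <= k < n) c k * X k w)))%:E <=
   (expR (kappa * \sum_(0 <= k < n) modulus (c k) ^+ 2))%:E)%E.
Proof.
pose phi k (p : R * R) := expR (complex.Re (c k) * p.1 - complex.Im (c k) * p.2).
have mphi k : measurable_fun [set: R * R] (phi k).
  have m1 : measurable_fun [set: R * R] (fun p : R * R => p.1) := measurable_fst.
  have m2 : measurable_fun [set: R * R] (fun p : R * R => p.2) := measurable_snd.
  by apply: measurableT_comp => //; apply: measurable_funB; exact: measurable_funM.
have phiE k w : phi k (re_im (X k w)) = expR (complex.Re (c k * X k w)).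
  by rewrite /phi/=; case: (c k) => ? ?; case: (X k w).
have mgf k := subgaussian_mgf (X_rv k) K0 tau0 (@X_subgaussian k) (c k) (X_centred k).
pose e k := fine (\int[P]_w (phi k (re_im (X k w)))%:E)%E.
have He k : (\int[P]_w (phi k (re_im (X k w)))%:E = (e k)%:E)%E.
  rewrite /e fineK// ge0_fin_numE; last first.
    by apply: integral_ge0 => w _; rewrite lee_fin expR_ge0.
  under eq_integral do rewrite phiE.
  exact: le_lt_trans (mgf k) (ltry _).
have He' k : 0 <= e k <= expR (kappa * modulus (c k) ^+ 2).
  rewrite -!lee_fin -He; apply/andP; split.
    by apply: integral_ge0 => w _; rewrite lee_fin expR_ge0.
  by under eq_integral do rewrite phiE; exact: mgf.
have := @integral_prod_independent _ _ _ _ _ P (fun k w => re_im (X k w)) phi e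
  X_rv independent_initial mphi (fun k y => expR_ge0 _) He n.
have -> : (\int[P]_w (expR (complex.Re (\sum_(0 <= k < n) c k * X k w)))%:E =
  \int[P]_w (\prod_(0 <= k < n) phi k (re_im (X k w)))%:E)%E.
  apply: eq_integral => w _; congr EFin.
  rewrite Re_sum expR_sum; apply: eq_bigr => k _; exact/esym.
move=> ->; rewrite lee_fin mulr_sumr expR_sum.
apply: ler_prod => k _; exact: He'.
Qed.

(* The exponential moments are summed over all indices with the weights
   (N + 2)^-8: their a.s. finite sum bounds every single term. *)
Lemma random_sums_uniform_bound (I : nat -> finType) (c : forall N, I N -> nat -> R[i])
    (A : R) : 0 < A -> (forall N, (#|I N| <= 16 * N.+2 ^ 6)%N) ->
  {ae P, forall w, exists2 Z, 0 <= Z & forall N i,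
    complex.Re (\sum_(0 <= n < N.+1) c N i n * X n w) <=
      Num.sqrt (A + \sum_(0 <= n < N.+1) modulus (c N i n) ^+ 2) *
      ((kappa + 8) * Num.sqrt (ln N.+2%:R) + Z)}.
Proof.
move=> A0 cardI.
pose V N i := A + \sum_(0 <= n < N.+1) modulus (c N i n) ^+ 2.
have V0 N i : 0 < V N i.
  by rewrite /V ltr_wpDr// sumr_ge0// => n _; exact: sqr_ge0.
pose l N : R := ln N.+2%:R.
have l0 N : 2^-1 <= l N.
  have h : ln 2 <= l N by rewrite /l ler_ln ?posrE// ler_nat.
  apply: le_trans h.
  have := @le_ln1Dx R (- 2^-1); rewrite (_ : 1 + - 2^-1 = 2^-1); last by field.
  by rewrite lnV ?posrE// lerN2; apply; rewrite ltrN2 invf_lt1// ltr1n.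
have lp N : 0 < l N by apply: lt_le_trans (l0 N); rewrite invr_gt0.
(* The Chernoff parameter is normalised by [s^2 V = ln (N+2)], so each exponential moment is at most
   [exp (kappa l)]; division by [V] is possible because [A > 0]. *)
pose s N i := Num.sqrt (l N / V N i).
have s0 N i : 0 < s N i by rewrite sqrtr_gt0 divr_gt0.
have sV N i : s N i ^+ 2 * V N i = l N.
  by rewrite sqr_sqrtr ?divfK ?gt_eqF// ltW// divr_gt0.
pose t N i w := s N i * complex.Re (\sum_(0 <= n < N.+1) c N i n * X n w).
(* There are at most [16 (N+2)^6] indices, so the exponent 8 leaves the summable [16 (N+2)^(-2)];
   its logarithm is the 8 in [kappa + 8]. *)
pose wt N : R := N.+2%:R ^- 8.
have wt0 N : 0 < wt N by rewrite invr_gt0 exprn_gt0.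
pose U N w := \sum_(i in I N) wt N * (expR (t N i w) * expR (- (kappa * l N))).
have tE N i w : t N i w =
    complex.Re (\sum_(0 <= n < N.+1) ((s N i)%:C * c N i n) * X n w).
  rewrite /t !Re_sum mulr_sumr; apply: eq_bigr => n _.
  rewrite -mulrA; case: (c N i n * X n w) => x y /=; ring.
have mt N i : measurable_fun [set: T] (t N i).
  rewrite (_ : t N i = fun w =>
    \sum_(0 <= n < N.+1) complex.Re (((s N i)%:C * c N i n) * X n w)).
    by apply: measurable_sum => n; exact: measurable_Re_mul.
  by apply/funext => w; rewrite tE Re_sum.
have int_t N i : (\int[P]_w (expR (t N i w) * expR (- (kappa * l N)))%:E <= 1)%E.
  under eq_integral do rewrite mulrC EFinM.
  rewrite ge0_integralZl//; last by apply/measurable_EFinP; exact: measurableT_comp.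
  under eq_integral do rewrite tE.
  have e0 : (0 <= (expR (- (kappa * l N)))%:E)%E by rewrite lee_fin expR_ge0.
  apply: le_trans (lee_wpmul2l e0 (random_sum_mgf _ _)) _.
  rewrite -EFinM lee_fin -expRD -[leRHS]expR0 ler_expR.
  have -> : \sum_(0 <= n < N.+1) modulus ((s N i)%:C * c N i n) ^+ 2 =
      s N i ^+ 2 * \sum_(0 <= n < N.+1) modulus (c N i n) ^+ 2.
    rewrite mulr_sumr; apply: eq_bigr => n _; rewrite modulusM exprMn; congr (_ * _).
    by rewrite sqr_modulus/= expr0n/= addr0.
  rewrite addrC subr_le0; apply: ler_wpM2l => //.
  by rewrite -(sV N i); apply: ler_wpM2l; [exact: sqr_ge0|rewrite /V lerDr ltW].
have U0 N w : 0 <= U N w.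
  apply: sumr_ge0 => i _; apply: mulr_ge0; first exact: ltW.
  by apply: mulr_ge0; exact: expR_ge0.
have mexp N i : measurable_fun [set: T] (fun w => expR (t N i w) * expR (- (kappa * l N))).
  by apply: measurable_funM => //; exact: measurableT_comp.
have mU N : measurable_fun [set: T] (U N).
  by apply: measurable_sum => i; exact: measurable_funM.
have EU N : (\int[P]_w (U N w)%:E <= (16 * N.+2%:R ^- 2)%:E)%E.
  rewrite /U; under eq_integral do rewrite -sumEFin.
  rewrite ge0_integral_sum//; last 2 first.
  - by move=> i; apply/measurable_EFinP; exact: measurable_funM.
  - move=> i w _; rewrite lee_fin; apply: mulr_ge0; first exact: ltW.
    by apply: mulr_ge0; exact: expR_ge0.
  apply: (@le_trans _ _ (\sum_(i in I N) (wt N)%:E)%E).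
    apply: lee_sum => i _.
    under eq_integral do rewrite EFinM.
    rewrite ge0_integralZl//; last 2 first.
    - exact/measurable_EFinP.
    - by rewrite lee_fin ltW.
    rewrite -[leRHS]mule1; apply: lee_wpmul2l; last exact: int_t.
    by rewrite lee_fin ltW.
  rewrite sumEFin lee_fin sumr_const -[X in X <= _]mulr_natl.
  apply: (@le_trans _ _ ((16 * N.+2 ^ 6)%:R * wt N)).
    by apply: ler_wpM2r; [exact: ltW|rewrite ler_nat].
  rewrite natrM natrX /wt le_eqVlt; apply/orP; left; apply/eqP.
  have : N.+2%:R != 0 :> R by [].
  by move: (N.+2%:R : R) => x x0; field.
have vS n : \sum_(0 <= k < n) (16 * k.+2%:R ^- 2 : R) <= 16.
  by rewrite -mulr_sumr -[leRHS]mulr1 ler_wpM2l// sum_inv_sqr_le1.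
have := ae_bounded_sums mU U0 EU vS.
apply: filterS => w [Z HZ].
pose Z1 := Num.max Z 1.
have Z11 : 1 <= Z1 by rewrite le_max lexx orbT.
have lZ0 : 0 <= ln Z1 by rewrite ln_ge0.
(* Division by [sqrt (l N) >= 1/2] at the end costs the factor 2. *)
exists (2 * ln Z1) => [|N i]; first by rewrite mulr_ge0.
have h : wt N * (expR (t N i w) * expR (- (kappa * l N))) <= Z1.
  apply: (@le_trans _ _ Z); last by rewrite le_max lexx.
  apply: le_trans (HZ N.+1); rewrite big_nat_recr//=.
  apply: (@le_trans _ _ (U N w)); last by rewrite lerDr sumr_ge0.
  rewrite /U (bigD1 i)//= lerDl sumr_ge0// => j _.
  by apply: mulr_ge0; [exact: ltW|apply: mulr_ge0; exact: expR_ge0].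
have {h} : t N i w - kappa * l N - 8 * l N <= ln Z1.
  rewrite -ler_expR lnK ?posrE ?(lt_le_trans _ Z11)//.
  apply: le_trans h; rewrite le_eqVlt; apply/orP; left; apply/eqP.
  rewrite !expRD mulrC; congr (_ * _).
  by rewrite /wt expRN mulr_natl -lnXn// lnK ?posrE ?exprn_gt0.
move=> h.
have sl0 : 0 < Num.sqrt (l N) by rewrite sqrtr_gt0.
have sl2 : Num.sqrt (l N) ^+ 2 = l N by rewrite sqr_sqrtr// ltW.
have sv0 : 0 < Num.sqrt (V N i) by rewrite sqrtr_gt0.
have sE : s N i = Num.sqrt (l N) / Num.sqrt (V N i).
  by rewrite /s sqrtrM ?ltW// sqrtrV// ltW.
have {h} : Num.sqrt (l N) * complex.Re (\sum_(0 <= n < N.+1) c N i n * X n w) <=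
   Num.sqrt (V N i) * ((kappa + 8) * l N + ln Z1).
  rewrite mulrC -ler_pdivrMl// mulrA mulrAC mulrC [_^-1 * _]mulrC -sE mulrC -/(t N i w).
  lra.
move=> h; rewrite -(ler_pM2l sl0); apply: le_trans h _.
rewrite mulrCA; apply: ler_wpM2l; first exact: ltW.
rewrite mulrDr mulrCA -expr2 sl2 lerD2l mulrA mulrC mulrA.
have : 2^-1 <= Num.sqrt (l N).
  rewrite -(@ler_pXn2r _ 2) ?nnegrE ?invr_ge0 ?(ltW sl0)// sl2.
  by apply: le_trans (l0 N); lra.
by have := lZ0; nra.
Qed.

End independent_subgaussian.
End random_sums.

(** * Deterministic bounds for random power series *)

Section grid.
Context (R : realType).

(** Each coordinate is a sign and a numerator, so that truncating its absolute value rounds toward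
    0, and the index ranges over a finite type with [4 (Q+1)^2] elements. *)
Definition grid_point (Q : nat) (i : bool * bool * ('I_Q.+1 * 'I_Q.+1)) : R[i] :=
  ((-1) ^+ i.1.1 * i.2.1%:R / Q%:R) +i* ((-1) ^+ i.1.2 * i.2.2%:R / Q%:R).

(* Rounding is toward 0, so the grid point lies in the disk through the given point. *)
Lemma grid_approx1 (Q : nat) (x : R) : (0 < Q)%N -> `|x| <= 1 ->
  exists (s : bool) (p : 'I_Q.+1), let y := (-1) ^+ s * p%:R / Q%:R in
    `|y| <= `|x| /\ `|x - y| <= Q%:R^-1.
Proof.
move=> Q0 x1; have Q0' : 0 < Q%:R :> R by rewrite ltr0n.
have xQ0 : 0 <= `|x| * Q%:R by rewrite mulr_ge0.
have /andP[p1 p2] := truncn_itv xQ0.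
set p := Num.truncn (`|x| * Q%:R) in p1 p2.
have pQ : (p < Q.+1)%N.
  rewrite ltnS -(ler_nat R); apply: le_trans p1 _.
  by rewrite -[leRHS]mul1r ler_wpM2r.
exists (x < 0)%R, (Ordinal pQ) => /=.
have y0 : 0 <= p%:R / Q%:R :> R by rewrite divr_ge0.
have yx : p%:R / Q%:R <= `|x| by rewrite ler_pdivrMr.
have xy : `|x| - p%:R / Q%:R <= Q%:R^-1.
  rewrite lerBlDr -[X in X + _]mul1r -mulrDl nat1r ler_pdivlMr//; exact: ltW.
have sx : (-1) ^+ (x < 0)%R * `|x| = x by rewrite -numEsign.
split; first by rewrite -mulrA normrM normrX normrN1 expr1n mul1r ger0_norm.
rewrite -[X in X - _]sx -mulrA -mulrBr normrM normrX normrN1 expr1n mul1r ger0_norm//.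
by rewrite subr_ge0.
Qed.

Lemma ler_modulus (x y : R[i]) : `|complex.Re x| <= `|complex.Re y| ->
  `|complex.Im x| <= `|complex.Im y| -> modulus x <= modulus y.
Proof.
move=> h1 h2; rewrite -(@ler_pXn2r _ 2) ?nnegrE ?modulus_ge0// !sqr_modulus.
have H (u v : R) : `|u| <= `|v| -> u ^+ 2 <= v ^+ 2.
  by move=> h; rewrite -real_normK ?num_real// -[leRHS]real_normK ?num_real// lerXn2r ?nnegrE.
by apply: lerD; exact: H.
Qed.

Lemma grid_approx (Q : nat) (z : R[i]) : (0 < Q)%N -> modulus z <= 1 ->
  exists i : bool * bool * ('I_Q.+1 * 'I_Q.+1),
    modulus (grid_point i) <= modulus z /\ modulus (z - grid_point i) <= 2 / Q%:R.
Proof.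
move=> Q0 z1.
have [s1 [p1 /= [h1 h2]]] := grid_approx1 Q0 (le_trans (norm_Re_modulus z) z1).
have [s2 [p2 /= [h3 h4]]] := grid_approx1 Q0 (le_trans (norm_Im_modulus z) z1).
exists ((s1, s2), (p1, p2)); split.
  exact: (@ler_modulus (grid_point ((s1, s2), (p1, p2))) z h1 h3).
apply: le_trans (modulus_le_ReIm _) _; rewrite Re_sub Im_sub mulr_natl mulr2n.
exact: lerD.
Qed.

(** The four rotations have real parts [Re z], [- Im z], [- Re z] and [Im z]. Exponential moments
    control real parts from above only, hence the index ['I_4] beside every grid point. *)
Lemma modulus_le_rotations (z : R[i]) (B : R) :
  (forall j : 'I_4, complex.Re ('i ^+ j * z) <= B) -> modulus z <= 2 * B.
Proof.
move=> H; apply: le_trans (modulus_le_ReIm _) _.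
have := H (inord 0); have := H (inord 1); have := H (inord 2); have := H (inord 3).
rewrite !inordK// expr0 mul1r expr1 !exprS expr0 mulr1; case: z {H} => x y /=.
by simpc => /= h3 h2 h1 h0; rewrite mulr_natl mulr2n lerD// ler_norml; apply/andP; split; lra.
Qed.

Lemma modulus_subX (z y : R[i]) (r : R) n : modulus z <= r -> modulus y <= r ->
  modulus (z ^+ n.+1 - y ^+ n.+1) <= n.+1%:R * r ^+ n * modulus (z - y).
Proof.
move=> zr yr; have r0 : 0 <= r by apply: le_trans (modulus_ge0 z) zr.
elim: n => [|n IH]; first by rewrite !expr1 mulr1 mul1r.
have -> : z ^+ n.+2 - y ^+ n.+2 = z * (z ^+ n.+1 - y ^+ n.+1) + (z - y) * y ^+ n.+1.
  by rewrite !(exprS _ n.+1); ring.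
apply: le_trans (ler_modulusD _ _) _; rewrite !modulusM modulusX.
have h1 : modulus z * modulus (z ^+ n.+1 - y ^+ n.+1) <=
    r * (n.+1%:R * r ^+ n * modulus (z - y)).
  by apply: ler_pM => //; exact: modulus_ge0.
have h2 : modulus (z - y) * modulus y ^+ n.+1 <= modulus (z - y) * r ^+ n.+1.
  by apply: ler_wpM2l; [exact: modulus_ge0|rewrite lerXn2r ?nnegrE ?modulus_ge0].
apply: le_trans (lerD h1 h2) _; rewrite le_eqVlt; apply/orP; left; apply/eqP.
by rewrite -[n.+2%:R]natr1 exprS; ring.
Qed.

(** Telescoping against [3 - 2 / sqrt n], which mimics the primitive [- 2 x^(-1/2)] of
    [x^(-3/2)]. *)
Lemma sum_inv_pow32_le3 (n : nat) :
  \sum_(0 <= k < n) (k.+1%:R * Num.sqrt k.+1%:R)^-1 <= 3 :> R.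
Proof.
case: n => [|n]; first by rewrite big_nil.
suff : \sum_(0 <= k < n.+1) (k.+1%:R * Num.sqrt k.+1%:R)^-1 <=
    3 - 2 / Num.sqrt n.+1%:R :> R.
  by move=> /le_trans; apply; rewrite lerBlDr lerDl divr_ge0 ?sqrtr_ge0.
elim: n => [|n IH].
  by rewrite big_nat1 sqrtr1 mulr1 invr1 mulr1; lra.
rewrite big_nat_recr//=; apply: le_trans (lerD IH (lexx _)) _.
set a := Num.sqrt n.+1%:R; set b := Num.sqrt n.+2%:R.
have a0 : 0 < a by rewrite sqrtr_gt0.
have b0 : 0 < b by rewrite sqrtr_gt0.
have aE : n.+1%:R = a ^+ 2 by rewrite sqr_sqrtr.
have bE : n.+2%:R = b ^+ 2 by rewrite sqr_sqrtr.
have ab : b ^+ 2 = a ^+ 2 + 1 by rewrite -aE -bE -natr1.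
have leab : a <= b by rewrite ler_sqrt// ler_nat.
rewrite bE -lerBrDl.
have -> : 3 - 2 / b - (3 - 2 / a) = 2 / (a * b * (a + b)).
  have E : b - a = (a + b)^-1.
    apply: (mulIf (_ : a + b != 0)); first by rewrite gt_eqF// addr_gt0.
    by rewrite mulVf ?gt_eqF ?addr_gt0//; move: ab; lra.
  have -> : 3 - 2 / b - (3 - 2 / a) = 2 * (b - a) / (a * b) by field; rewrite !gt_eqF.
  by rewrite E invfM; field; rewrite !gt_eqF ?addr_gt0.
rewrite ler_pdivlMr ?mulr_gt0 ?addr_gt0// mulrC ler_pdivrMr ?mulr_gt0 ?exprn_gt0//.
have p : a * (a + b) <= 2 * b ^+ 2 by nra.
rewrite mulrC; have := ler_wpM2l (ltW b0) p; nra.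
Qed.

End grid.
Arguments grid_point {R Q}.

(** The mesh [(N+1)^(-3)] gives [(Q+1)^2 <= (N+2)^6] pairs of numerators; 16 counts two signs and
    four rotations. *)
Lemma card_grid_index (N : nat) :
  (#|{: (bool * bool * ('I_(N.+1 ^ 3).+1 * 'I_(N.+1 ^ 3).+1) * 'I_4)%type}| <=
    16 * N.+2 ^ 6)%N.
Proof.
rewrite !card_prod !card_ord !card_bool.
have -> : (N.+2 ^ 6 = N.+2 ^ 3 * N.+2 ^ 3)%N by rewrite -expnD.
have h : ((N.+1 ^ 3).+1 <= N.+2 ^ 3)%N.
  by rewrite (ltn_exp2r _ _ (isT : 0 < 3)%N).
rewrite [(2 * 2 * _ * 4)%N]mulnAC; exact: leq_mul (leqnn _) (leq_mul h h).
Qed.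

Lemma term_le_bounded_sums (R : realType) (u : nat -> R) (B : R) k : (forall n, 0 <= u n) ->
  (forall n, \sum_(0 <= k < n) u k <= B) -> u k <= B.
Proof.
move=> u0 uB; apply: le_trans (uB k.+1); rewrite big_nat_recr//= lerDr.
exact: sumr_ge0.
Qed.

(** A single term gives [|x_k|^2 <= W (k+1)^(3/2) <= (1+W)^2 (k+1)^2]. Linear growth of [x_k] keeps
    the radius of convergence at least 1. *)
Lemma modulus_le_weighted_sum (R : realType) (x : nat -> R[i]) (W : R) k :
  (forall n, \sum_(0 <= k < n) modulus (x k) ^+ 2 / (k.+1%:R * Num.sqrt k.+1%:R) <= W) ->
  modulus (x k) <= (1 + W) * k.+1%:R.
Proof.
move=> HW; have W0 : 0 <= W by have := HW 0; rewrite big_nil.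
have k0 : 0 < k.+1%:R :> R by [].
have s0 : 0 < Num.sqrt k.+1%:R :> R by rewrite sqrtr_gt0.
have : modulus (x k) ^+ 2 / (k.+1%:R * Num.sqrt k.+1%:R) <= W.
  apply: (term_le_bounded_sums
    (u := fun k => modulus (x k) ^+ 2 / (k.+1%:R * Num.sqrt k.+1%:R))) => // n.
  by apply: divr_ge0; [exact: sqr_ge0|exact: mulr_ge0].
rewrite ler_pdivrMr ?mulr_gt0// => h.
rewrite -(@ler_pXn2r _ 2) ?nnegrE ?modulus_ge0//; last first.
  by apply: mulr_ge0 => //; apply: addr_ge0.
apply: le_trans h _; rewrite exprMn.
have s1 : Num.sqrt k.+1%:R <= k.+1%:R :> R.
  rewrite -(@ler_pXn2r _ 2) ?nnegrE ?(ltW s0) ?(ltW k0)// sqr_sqrtr ?(ltW k0)//.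
  by rewrite ler_eXnr// ler1n.
apply: ler_pM => //; first by nra.
by rewrite expr2; apply: ler_wpM2l => //; exact: ltW.
Qed.

(** * Bound on a circle: head at a grid point, rounding error and tail *)

Section deterministic_bound.
Context (R : realType).
Variables (a x : nat -> R[i]) (A Phi q r W G : R) (N : nat) (z : R[i]).
Hypothesis zr : modulus z = r.
Hypothesis r12 : 2^-1 <= r.
Hypothesis r1 : r < 1.
Hypothesis A0 : 0 <= A.
Hypothesis Phi0 : 0 < Phi.
Hypothesis HPhi : forall n, A + \sum_(0 <= k < n) modulus (a k) ^+ 2 * (r ^+ k) ^+ 2 <= Phi.
Hypothesis Hq : forall n,
  \sum_(0 <= k < n) k.+1%:R ^+ 2 * (modulus (a k) ^+ 2 * (r ^+ k) ^+ 2) <= Phi * q.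
Hypothesis q0 : 0 <= q.
Hypothesis qN : q ^+ 2 <= N.+1%:R.
Hypothesis HW : forall n,
  \sum_(0 <= k < n) modulus (x k) ^+ 2 / (k.+1%:R * Num.sqrt k.+1%:R) <= W.
Hypothesis G0 : 0 <= G.
Hypothesis HG : forall i (j : 'I_4),
  complex.Re (\sum_(0 <= k < N.+1)
    ('i ^+ j * (a k * @grid_point R (N.+1 ^ 3) i ^+ k)) * x k) <=
  Num.sqrt (A + \sum_(0 <= k < N.+1)
    modulus ('i ^+ j * (a k * @grid_point R (N.+1 ^ 3) i ^+ k)) ^+ 2) * G.

Let r0 : 0 < r.
Proof. by apply: lt_le_trans r12; rewrite invr_gt0. Qed.

Let W0 : 0 <= W.
Proof. by have := HW 0; rewrite big_nil. Qed.

Let sPhi0 : 0 < Num.sqrt Phi.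
Proof. by rewrite sqrtr_gt0. Qed.

Let coef_le k : modulus (a k) * r ^+ k <= Num.sqrt Phi.
Proof.
have p : 0 <= modulus (a k) * r ^+ k.
  by apply: mulr_ge0; [exact: modulus_ge0|rewrite exprn_ge0 ?(ltW r0)].
rewrite -[leLHS](ger0_norm p) -sqrtr_sqr ler_sqrt ?(ltW Phi0)// exprMn.
apply: (term_le_bounded_sums (u := fun k => modulus (a k) ^+ 2 * (r ^+ k) ^+ 2)) => n.
  by apply: mulr_ge0; exact: sqr_ge0.
by apply: le_trans (HPhi n); rewrite lerDr.
Qed.

Let x_le k : modulus (x k) <= (1 + W) * k.+1%:R.
Proof. exact: modulus_le_weighted_sum. Qed.

(** For [k > N] the weight satisfies [(k+1)^(3/2) <= (k+1)^2 / sqrt (N+1)], so the second moment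
    bound gives [Phi q / sqrt (N+1) <= Phi]: this is why [q^2 <= N + 1] is asked for. *)
Let tail_bound M : (N.+1 <= M)%N ->
  modulus (\sum_(N.+1 <= k < M) a k * x k * z ^+ k) <= Num.sqrt Phi * (1 + W).
Proof.
move=> NM; apply: le_trans (modulus_sum _ _ _) _.
pose s k : R := Num.sqrt k.+1%:R.
have s0 k : 0 < s k by rewrite sqrtr_gt0.
pose f k := k.+1%:R ^+ 2 * (modulus (a k) ^+ 2 * (r ^+ k) ^+ 2) / s N.
pose g k := modulus (x k) ^+ 2 / (k.+1%:R * s k).
set S := Num.sqrt Phi.
have S2 : S ^+ 2 = Phi by rewrite sqr_sqrtr// ltW.
apply: (@le_trans _ _ (\sum_(N.+1 <= k < M) (S^-1 * f k + S * g k))).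
  apply: ler_sum_nat => k /andP[Nk _].
  rewrite !modulusM modulusX zr.
  set u := modulus (a k) * r ^+ k; set v := modulus (x k).
  have -> : modulus (a k) * modulus (x k) * r ^+ k = u * v by rewrite /u /v; ring.
  rewrite /f -exprMn -/u /g -/v.
  have u0 : 0 <= u by apply: mulr_ge0; [exact: modulus_ge0|rewrite exprn_ge0 ?(ltW r0)].
  have v0 : 0 <= v by exact: modulus_ge0.
  have k0 : 0 < k.+1%:R :> R by [].
  have sNk : s N <= s k by rewrite ler_sqrt// ler_nat ltnS ltnW.
  have E : k.+1%:R = s k ^+ 2 :> R by rewrite sqr_sqrtr.
  (* AM-GM: [u v <= t u^2 / S + S v^2 / t] with [t = (k + 1)^(3/2)] *)
  apply: (@le_trans _ _ (S^-1 * (s k ^+ 3 * u ^+ 2) + S * (v ^+ 2 / (s k ^+ 3)))).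
    have t0 : 0 < s k ^+ 3 by rewrite exprn_gt0.
    move: (s k ^+ 3) t0 => t t0.
    have -> : S^-1 * (t * u ^+ 2) + S * (v ^+ 2 / t) = 
       ((t * u) ^+ 2 + (S * v) ^+ 2) / (S * t) by field; rewrite !gt_eqF.
    rewrite ler_pdivlMr ?mulr_gt0//.
    have := sqr_ge0 (t * u - S * v).
    have : 0 <= (t * u) * (S * v).
      by apply: mulr_ge0; apply: mulr_ge0 => //; exact: ltW.
    by move=> h1 h2; lra.
  rewrite E -exprSr lerD2r; apply: ler_wpM2l; first by rewrite invr_ge0 ltW.
  rewrite ler_pdivlMr// -exprM mulrAC; apply: ler_wpM2r; first exact: sqr_ge0.
  by rewrite (exprSr (s k) 3); apply: ler_wpM2l => //; rewrite exprn_ge0 ?(ltW (s0 _)).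
have ext (F : nat -> R) : (forall k, 0 <= F k) ->
    \sum_(N.+1 <= k < M) F k <= \sum_(0 <= k < M) F k.
  by move=> F0; rewrite (big_cat_nat (leq0n N.+1) NM)//= lerDr sumr_ge0.
rewrite big_split/= -!mulr_sumr mulrDr mulr1; apply: lerD.
  rewrite mulrC ler_pdivrMr// -expr2 S2.
  apply: le_trans (ext f _) _ => [k|].
    apply: divr_ge0; last exact: ltW.
    by apply: mulr_ge0; [exact: sqr_ge0|apply: mulr_ge0; exact: sqr_ge0].
  rewrite -mulr_suml ler_pdivrMr//; apply: le_trans (Hq M) _.
  apply: ler_wpM2l; first exact: ltW.
  by rewrite -[leLHS](ger0_norm q0) -sqrtr_sqr ler_sqrt.
apply: ler_wpM2l; first exact: ltW.
apply: le_trans (ext g _) (HW M) => k.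
by apply: divr_ge0; [exact: sqr_ge0|apply: mulr_ge0 => //; exact: ltW].
Qed.

(** Because the grid point has modulus at most [r], the variance in [HG] is bounded by [Phi], which
    is taken at [r]. *)
Let head_bound (i : bool * bool * ('I_(N.+1 ^ 3).+1 * 'I_(N.+1 ^ 3).+1)) :
  modulus (@grid_point R (N.+1 ^ 3) i) <= r ->
  modulus (\sum_(0 <= k < N.+1) a k * x k * grid_point i ^+ k) <= 2 * (Num.sqrt Phi * G).
Proof.
move=> ir; apply: modulus_le_rotations => j.
have -> : 'i ^+ j * \sum_(0 <= k < N.+1) a k * x k * grid_point i ^+ k =
   \sum_(0 <= k < N.+1) 'i ^+ j * (a k * grid_point i ^+ k) * x k :> R[i].
  by rewrite mulr_sumr; apply: eq_bigr => k _; ring.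
apply: le_trans (HG i j) _; apply: ler_wpM2r => //; rewrite ler_sqrt ?(ltW Phi0)//.
apply: le_trans (HPhi N.+1); rewrite lerD2l; apply: ler_sum => k _.
rewrite !modulusM !modulusX.
have -> : modulus 'i = 1 :> R by rewrite /modulus/= expr0n/= expr1n add0r sqrtr1.
rewrite expr1n mul1r exprMn; apply: ler_wpM2l; first exact: sqr_ge0.
rewrite lerXn2r ?nnegrE ?exprn_ge0 ?modulus_ge0 ?(ltW r0)//.
by rewrite lerXn2r ?nnegrE ?modulus_ge0 ?(ltW r0).
Qed.

(** In each term, [x_k] and the derivative of the power cost a factor [N + 1] each and there are
    [N + 1] terms; the cubic mesh compensates all three. Replacing [r^k] by [2 r^(k+1)] uses
    [r >= 1/2]. *)
Let difference_bound (y : R[i]) : modulus y <= r ->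
  modulus (z - y) <= 2 / (N.+1 ^ 3)%:R ->
  modulus (\sum_(0 <= k < N.+1) a k * x k * z ^+ k - \sum_(0 <= k < N.+1) a k * x k * y ^+ k)
    <= 4 * (Num.sqrt Phi * (1 + W)).
Proof.
move=> yr zy; rewrite -sumrB; apply: le_trans (modulus_sum _ _ _) _.
have N0 : 0 < N.+1%:R :> R by [].
apply: (@le_trans _ _ (\sum_(0 <= k < N.+1) 4 * (Num.sqrt Phi * (1 + W)) / N.+1%:R)).
  rewrite big_nat [leRHS]big_nat; apply: ler_sum => -[|k] /andP[_ kN].
    rewrite !expr0 subrr modulus0 divr_ge0// mulr_ge0// mulr_ge0 ?(ltW sPhi0)//.
    by rewrite addr_ge0.
  rewrite -mulrBr !modulusM.
  have zler : modulus z <= r by rewrite zr.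
  have h := modulus_subX k zler yr.
  have k0 : 0 < k.+1%:R :> R by [].
  have a0 := modulus_ge0 (a k.+1); have xx0 := modulus_ge0 (x k.+1).
  have rk : 0 <= r ^+ k by rewrite exprn_ge0 ?(ltW r0).
  have {}h : modulus (z ^+ k.+1 - y ^+ k.+1) <=
      2 * r ^+ k.+1 * (N.+1%:R * (2 / (N.+1 ^ 3)%:R)).
    apply: le_trans h _.
    have -> : k.+1%:R * r ^+ k * modulus (z - y) =
      r ^+ k * (k.+1%:R * modulus (z - y)) by ring.
    apply: ler_pM => //; first by apply: mulr_ge0 => //; exact: modulus_ge0.
      by rewrite exprS mulrA ler_peMl//; move: r12; lra.
    by apply: ler_pM => //; [exact: modulus_ge0|rewrite ler_nat ltnW].
  apply: (@le_trans _ _ (modulus (a k.+1) * ((1 + W) * N.+1%:R) *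
      (2 * r ^+ k.+1 * (N.+1%:R * (2 / (N.+1 ^ 3)%:R))))).
    apply: ler_pM => //; [exact: mulr_ge0|exact: modulus_ge0|].
    apply: ler_wpM2l => //; apply: le_trans (x_le _) _.
    by apply: ler_wpM2l; [exact: addr_ge0|rewrite ler_nat].
  have -> : modulus (a k.+1) * ((1 + W) * N.+1%:R) *
      (2 * r ^+ k.+1 * (N.+1%:R * (2 / (N.+1 ^ 3)%:R))) =
      4 * ((modulus (a k.+1) * r ^+ k.+1) * (1 + W)) / N.+1%:R.
    rewrite natrX; move: (r ^+ k.+1) N0 => y0; move: (N.+1%:R : R) => t t0.
    by field; rewrite gt_eqF.
  apply: ler_wpM2r; first by rewrite invr_ge0.
  apply: ler_wpM2l => //; apply: ler_wpM2r; first exact: addr_ge0.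
  exact: coef_le.
rewrite sumr_const_nat subn0 -[leLHS]mulr_natr divfK// gt_eqF//.
Qed.

(** The constant 5 is 4 from rounding plus 1 from the tail, and 2 comes from the rotations. The
    bound is uniform in [M], so it passes to the limit of the partial sums. *)
Lemma random_series_bound M : (N.+1 <= M)%N ->
  modulus (\sum_(0 <= k < M) a k * x k * z ^+ k) <=
    Num.sqrt Phi * (2 * G + 5 * (1 + W)).
Proof.
move=> NM.
have Q0 : (0 < N.+1 ^ 3)%N by rewrite expn_gt0.
have z1 : modulus z <= 1 by rewrite zr ltW.
have [i [h1 h2]] := grid_approx Q0 z1; rewrite zr in h1.
rewrite (big_cat_nat (leq0n N.+1) NM)//=.
rewrite -[X in X + _](subrK (\sum_(0 <= k < N.+1) a k * x k * grid_point i ^+ k)).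
apply: le_trans (ler_modulusD _ _) _.
apply: le_trans (lerD (ler_modulusD _ _) (lexx _)) _.
apply: le_trans (lerD (lerD (difference_bound h1 h2) (head_bound h1)) (tail_bound NM)) _.
by rewrite le_eqVlt; apply/orP; left; apply/eqP; ring.
Qed.

End deterministic_bound.

(** * Exceptional sets of finite logarithmic measure *)

Section growth_lemma.
Context (R : realType).
Variables (u v : R -> R) (e : R).
Hypothesis e0 : 0 < e.
Hypothesis du : forall r : R, -1 < r < 1 -> is_derive r (1 : R) u (v r).
Hypothesis cv : forall r : R, -1 < r < 1 -> {for r, continuous v}.
Hypothesis v0 : forall r : R, 0 <= r < 1 -> 0 <= v r.
Hypothesis u_gt : forall r : R, -1 < r < 1 -> expR 1 <= u r.

(** The set where [v <= u (ln u)^(1+e) / (1-r)] fails, [v] being the derivative of [u]. The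
    regularity hypotheses are on []-1, 1[] so that 0 is an interior point with two-sided
    derivatives. *)
Definition growth_exceptional_set : set R :=
  [set r | 0 <= r < 1 /\ u r * ln (u r) `^ (1 + e) < (1 - r) * v r].

Let cu (r : R) : -1 < r < 1 -> {for r, continuous u}.
Proof.
move=> r1; have [du1 _] := du r1.
exact/differentiable_continuous/derivable1_diffP.
Qed.

Let u_gt0 (r : R) : -1 < r < 1 -> 0 < u r.
Proof. by move=> r1; apply: lt_le_trans (u_gt r1); exact: expR_gt0. Qed.

Let lnu_ge1 (r : R) : -1 < r < 1 -> 1 <= ln (u r).
Proof.
by move=> r1; rewrite -[leLHS]expRK ler_ln ?posrE ?expR_gt0 ?u_gt0// u_gt.
Qed.

Let lnu_gt0 (r : R) : -1 < r < 1 -> 0 < ln (u r).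
Proof. by move=> /lnu_ge1; exact: lt_le_trans. Qed.

Let measurable_on (f : R -> R) : (forall r : R, -1 < r < 1 -> {for r, continuous f}) ->
  measurable_fun (`]-1, 1[%classic : set R) (f : R -> R).
Proof.
move=> cf; apply: open_continuous_measurable_fun; first exact: interval_open.
by move=> x /[!inE]/=; rewrite in_itv/=; exact: cf.
Qed.

Lemma measurable_growth_exceptional_set : measurable growth_exceptional_set.
Proof.
pose g r := (1 - r) * v r - u r * ln (u r) `^ (1 + e).
have mu := measurable_on cu; have mv := measurable_on cv.
have mg : measurable_fun (`]-1, 1[%classic : set R) g.
  apply: measurable_funB; first by apply: measurable_funM => //; exact: measurable_funB.
  apply: measurable_funM => //; apply: (measurableT_comp (measurable_powR (1 + e))).
  exact: (measurableT_comp (@measurable_ln R)).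
rewrite (_ : growth_exceptional_set =
    `[0, 1[%classic `&` (`]-1, 1[%classic `&` g @^-1` `]0, +oo[%classic)).
  by apply: measurableI => //; exact: mg.
apply/seteqP; split => r /=; rewrite !in_itv/= andbT subr_gt0.
  move=> [/andP[r0 r1] h]; rewrite r0 r1 h; split => //; split => //.
  by rewrite andbT (lt_le_trans _ r0).
by move=> [r01 [_ h]].
Qed.

(* A bounded primitive of [w], and [w] dominates [1 / (1 - r)] on the exceptional set. *)
Let phi r := - (e^-1 * ln (u r) `^ (- e)).
Let w r := ln (u r) `^ (- e - 1) * (v r / u r).

Let dphi (r : R) : -1 < r < 1 -> is_derive r (1 : R) phi (w r).
Proof.
move=> r1.
have d1 : is_derive r (1 : R) u (v r) := du r1.
have d2 : is_derive (u r) (1 : R) (@ln R) (u r)^-1 := is_derive1_ln (u_gt0 r1).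
have d3 := is_derive1_comp d2 d1.
have d4 : is_derive ((@ln R \o u) r) (1 : R) (@powR R ^~ (- e)) _ :=
  is_derive1_powR (- e) (lnu_gt0 r1).
have d5 := is_derive1_comp d4 d3.
have d6 := is_deriveN (is_deriveZ (e^-1) d5).
have -> : w r = - (e^-1 *: ((- e * ln (u r) `^ (- e - 1)) * ((u r)^-1 * v r))).
  rewrite /w /GRing.scale/=; move: (_ `^ _) => p; field.
  by rewrite !gt_eqF// u_gt0.
exact: d6.
Qed.

Let cw (r : R) : -1 < r < 1 -> {for r, continuous w}.
Proof.
move=> r1; have cur := cu r1.
have cl : {for r, continuous (fun x => ln (u x))}.
  apply: (continuous_comp cur); exact: (continuous_ln (u_gt0 r1)).
apply: continuousM.
  apply: (@continuous_comp _ _ _ _ (@powR R ^~ (- e - 1))) => //.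
  have [dp _] := is_derive1_powR (- e - 1) (lnu_gt0 r1).
  exact/differentiable_continuous/derivable1_diffP.
apply: continuousM; first exact: cv.
by apply: continuousV => //; rewrite gt_eqF// u_gt0.
Qed.

Let w_ge0 (r : R) : 0 <= r < 1 -> 0 <= w r.
Proof.
move=> /[dup] r01 /andP[r0 r1]; apply: mulr_ge0; first exact: powR_ge0.
apply: divr_ge0; first exact: v0.
by apply/ltW/u_gt0; rewrite r1 (lt_le_trans _ r0).
Qed.

(** The primitive [phi] is nonpositive, and [phi 0 >= - 1/e] because [ln (u 0) >= 1]; the bound does
    not depend on [t]. *)
Let int_w (t : R) : 0 < t < 1 ->
  (\int[@lebesgue_measure R]_(r in `[0%R, t]) (w r)%:E <= (e^-1)%:E)%E.
Proof.
move=> /andP[t0 t1].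
have inI x : x \in `[0, t] -> -1 < x < 1.
  by rewrite in_itv/= => /andP[x0 xt]; rewrite (lt_le_trans _ x0)// (le_lt_trans xt).
have cphi x : x \in `[0, t] -> {for x, continuous phi}.
  move=> /inI x1; have [dp _] := dphi x1.
  exact/differentiable_continuous/derivable1_diffP.
rewrite (@continuous_FTC2 _ w phi 0 t)//.
- rewrite -EFinB lee_fin /phi opprK.
  have z1 : -1 < (0 : R) < 1 by rewrite ltrN10 ltr01.
  have e1 : 0 < e^-1 by rewrite invr_gt0.
  have h1 : ln (u 0) `^ (- e) <= 1.
    rewrite powRN invf_le1 ?powR_gt0 ?lnu_gt0//.
    by rewrite -[leLHS](powRr0 (ln (u 0))) ler_powR ?lnu_ge1 ?ltW.
  have h2 : 0 <= ln (u t) `^ (- e) by exact: powR_ge0.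
  have := ler_wpM2l (ltW e1) h1; have := ler_wpM2l (ltW e1) h2.
  by rewrite mulr0 mulr1 => h3 h4; lra.
- apply: continuous_in_subspaceT => x /[!inE] /inI; exact: cw.
- split.
  + move=> x xt; have [] // := dphi (inI x _).
    by move: xt; rewrite !in_itv/= => /andP[/ltW -> /ltW ->].
  + by apply: cvg_at_right_filter; apply: cphi; rewrite in_itv/= lexx ltW.
  + by apply: cvg_at_left_filter; apply: cphi; rewrite in_itv/= lexx ltW.
- move=> x xt; have dx := dphi (inI x _).
  rewrite derive1E; have [|_ //] := dx.
  by move: xt; rewrite !in_itv/= => /andP[/ltW -> /ltW ->].
Qed.

(** The fundamental theorem of calculus applies on the compact intervals [[0, t n]] only; the
    uniform bound [1/e] survives the monotone limit as [t n] increases to 1. *)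
Lemma finite_log_measure_growth_exceptional_set :
  finite_log_measure growth_exceptional_set.
Proof.
have mE := measurable_growth_exceptional_set.
pose t n : R := 1 - n.+2%:R^-1.
have t01 n : 0 < t n < 1.
  rewrite /t subr_gt0 invf_lt1// ltr1n/= ltrBlDr ltrDl invr_gt0//.
pose F n := growth_exceptional_set `&` `[0, t n]%classic.
have EF : growth_exceptional_set = \bigcup_n F n.
  apply/seteqP; split => [r Er|r [n _ []//]].
  have [/andP[r0 r1] _] := Er.
  have d0 : 0 < 1 - r by rewrite subr_gt0.
  exists (Num.truncn (1 - r)^-1) => //; split => //=; rewrite in_itv/= r0/= /t.
  rewrite lerBrDr -lerBrDl -[leRHS]invrK lef_pV2 ?posrE ?invr_gt0//.
  apply: ltW; apply: lt_trans (truncnS_gt _) _; by rewrite ltr_nat.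
have mF n : measurable (F n) by apply: measurableI.
have mD n : measurable_fun (F n) (fun r : R => ((1 - r)^-1)%:E).
  apply/measurable_EFinP; apply: (@measurable_funS _ _ _ _ (`]-1, 1[%classic : set R)) => //.
    move=> r [[/andP[r0 r1] _] _] /=; rewrite in_itv/= r1 andbT.
    exact: lt_le_trans r0.
  apply: measurable_on => r /andP[_ r1]; apply: continuousV.
    by rewrite gt_eqF// subr_gt0.
  by apply: continuousB; [exact: cst_continuous|exact: cvg_id].
have D0 r : growth_exceptional_set r -> (0 <= ((1 - r)^-1)%:E)%E.
  by move=> [/andP[_ r1] _]; rewrite lee_fin invr_ge0 subr_ge0 ltW.
rewrite /finite_log_measure EF.
have ndF : nondecreasing_seq F.
  move=> m n mn; apply/subsetPset => r [Er]; rewrite /= in_itv/= => /andP[r0 h].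
  split => //=; rewrite in_itv/= r0/=.
  apply: le_trans h _; rewrite /t lerD2l lerN2 lef_pV2 ?posrE// ler_nat.
  by rewrite !ltnS.
have cvF : (\int[@lebesgue_measure R]_(r in F n) ((1 - r)^-1)%:E @[n --> \oo] -->
    \int[@lebesgue_measure R]_(r in \bigcup_n F n) ((1 - r)^-1)%:E)%E.
  by apply: ge0_nondecreasing_set_cvg_integral => // n r [/D0].
apply: (@le_lt_trans _ _ (e^-1)%:E); last exact: ltry.
rewrite -(cvg_lim _ cvF)//; apply: lime_le; first by apply/cvg_ex; eexists; exact: cvF.
apply: nearW => n; apply: le_trans (int_w (t01 n)).
have /andP[tn0 tn1] := t01 n.
have sub1 : `[0, t n]%classic `<=` (`]-1, 1[%classic : set R).
  move=> r /=; rewrite !in_itv/= => /andP[r0 rt].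
  by rewrite (lt_le_trans _ r0)// (le_lt_trans rt).
have mw : measurable_fun (`[0, t n]%classic : set R) (fun r => (w r)%:E).
  apply/measurable_EFinP; apply: measurable_funS sub1 (measurable_on cw) => //.
have w0 r : (`[0, t n]%classic : set R) r -> (0 <= (w r)%:E)%E.
  rewrite /= in_itv/= => /andP[r0 rt]; rewrite lee_fin w_ge0// r0/=.
  exact: le_lt_trans rt _.
apply: (@le_trans _ _ (\int[@lebesgue_measure R]_(r in F n) (w r)%:E)%E); last first.
  apply: ge0_subset_integral; [exact: mF|exact: measurable_itv|exact: mw|exact: w0|].
  by move=> r [].
apply: ge0_le_integral; [exact: mF|by move=> r [Er _]; exact: D0|exact: mD| |].
  by apply: measurable_funS mw => // r [].
move=> r [[/andP[r0 r1] h] _]; rewrite lee_fin.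
have r11 : -1 < r < 1 by rewrite r1 (lt_le_trans _ r0).
have d0 : 0 < 1 - r by rewrite subr_gt0.
have up := u_gt0 r11; have lp := lnu_gt0 r11.
have pp : 0 < ln (u r) `^ (1 + e) by rewrite powR_gt0.
have -> : w r = v r / (u r * ln (u r) `^ (1 + e)).
  rewrite /w (_ : - e - 1 = - (1 + e)); last by ring.
  rewrite powRN; move: (_ `^ _) pp => p pp; field.
  by rewrite !gt_eqF.
rewrite ler_pdivlMr ?mulr_gt0// mulrC ler_pdivrMr//.
by rewrite [leRHS]mulrC ltW.
Qed.

End growth_lemma.

Section finite_log_measure_union.
Context (R : realType).

Lemma finite_log_measureU (E F : set R) : measurable E -> measurable F ->
  E `<=` `[0, 1[%classic -> F `<=` `[0, 1[%classic ->
  finite_log_measure E -> finite_log_measure F -> finite_log_measure (E `|` F).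
Proof.
move=> mE mF E01 F01 fE fF.
have cD (r : R) : r < 1 -> {for r, continuous (fun r : R => (1 - r)^-1)}.
  move=> r1; apply: continuousV; first by rewrite gt_eqF// subr_gt0.
  by apply: continuousB; [exact: cst_continuous|exact: cvg_id].
have mD (D : set R) : measurable D -> D `<=` `[0, 1[%classic ->
    measurable_fun D (fun r : R => ((1 - r)^-1)%:E).
  move=> _ D01; apply/measurable_EFinP.
  apply: (@measurable_funS _ _ _ _ (`]-1, 1[%classic : set R)) => //.
    move=> r /D01 /=; rewrite !in_itv/= => /andP[r0 ->]; rewrite andbT.
    exact: lt_le_trans r0.
  apply: open_continuous_measurable_fun; first exact: interval_open.
  move=> r /[!inE]/=; rewrite in_itv/= => /andP[_ r1]; exact: cD.
have D0 (D : set R) r : D `<=` `[0, 1[%classic -> D r -> (0 <= ((1 - r)^-1)%:E)%E.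
  move=> D01 /D01; rewrite /= in_itv/= => /andP[_ r1].
  by rewrite lee_fin invr_ge0 subr_ge0 ltW.
have mFE : measurable (F `\` E) by exact: measurableD.
have EF01 : E `|` F `<=` `[0, 1[%classic by move=> r [/E01|/F01].
have EFE : E `|` F = E `|` (F `\` E) by rewrite setUDr setDv setD0.
rewrite /finite_log_measure EFE ge0_integral_setU; [|exact: mE|exact: mFE| | |]; last 3 first.
- by apply: mD; [exact: measurableU|rewrite -EFE].
- by move=> r; rewrite -EFE; exact: D0.
- by apply/disj_setPS => r [Er []].
apply: lte_add_pinfty => //; apply: le_lt_trans fF.
apply: ge0_subset_integral; [exact: mFE|exact: mF|exact: mD| |by move=> r []].
by move=> r; exact: D0.
Qed.

End finite_log_measure_union.

(** * Index distribution of a power series *)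

Section power_series_moments.
Context (R : realType).
Variable b : nat -> R.
Hypothesis b_bounded : disk_bounded b.
Hypothesis b_ge0 : forall n, 0 <= b n.
Hypothesis b0 : expR (expR 1) <= b 0.

Let b1 := pseries_diffs b.
Let b2 := pseries_diffs b1.

Definition gen_fun (c : nat -> R) (x : R) : R := limn (pseries c x).

(* Mean and variance of the index n under the probabilities b_n x^n / sum_k b_k x^k. *)
Definition gen_mean (x : R) : R := x * gen_fun b1 x / gen_fun b x.

Definition gen_var (x : R) : R :=
  (x * gen_fun b1 x + x ^+ 2 * gen_fun b2 x) / gen_fun b x - gen_mean x ^+ 2.

Let bounded_diffs (c : nat -> R) : disk_bounded c -> disk_bounded (pseries_diffs c).
Proof. by move=> /disk_bounded_shift /disk_bounded_mulS. Qed.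

Let cvg_pseries (c : nat -> R) (x : R) : disk_bounded c -> `|x| < 1 ->
  cvgn (pseries c x).
Proof.
move=> hc x1; apply: normed_cvg; rewrite /normed_series_of/=.
have := disk_bounded_cvg hc (_ : 0 <= `|x| < 1); rewrite normr_ge0 x1 => /(_ isT).
by congr (cvgn (series _)); apply/funext => n; rewrite normrM normrX.
Qed.

Let is_derive_gen_fun (c : nat -> R) (x : R) : disk_bounded c -> `|x| < 1 ->
  is_derive x (1 : R) (gen_fun c) (gen_fun (pseries_diffs c) x).
Proof.
move=> hc x1; pose K := (1 + `|x|) / 2.
have x0 := normr_ge0 x.
have K0 : 0 <= K by rewrite /K; lra.
have K1 : `|K| < 1 by rewrite ger0_norm// /K; lra.
have h1 := bounded_diffs hc; have h2 := bounded_diffs h1.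
apply: (@pseries_snd_diffs _ c K); try exact: cvg_pseries.
by rewrite [ltRHS]ger0_norm// /K; lra.
Qed.

Let continuous_gen_fun (c : nat -> R) (x : R) : disk_bounded c -> `|x| < 1 ->
  {for x, continuous (gen_fun c)}.
Proof.
move=> hc x1; have [dc _] := is_derive_gen_fun hc x1.
exact/differentiable_continuous/derivable1_diffP.
Qed.

Let hd1 := bounded_diffs b_bounded.
Let hd2 := bounded_diffs hd1.

Let b1_ge0 n : 0 <= b1 n.
Proof. by rewrite mulr_ge0. Qed.

Let norm01 (x : R) : 0 <= x < 1 -> `|x| < 1.
Proof. by move=> /andP[x0 x1]; rewrite ger0_norm. Qed.

Lemma partial_sum_le_gen_fun (c : nat -> R) (x : R) n : disk_bounded c ->
  (forall n, 0 <= c n) -> 0 <= x < 1 ->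
  \sum_(0 <= k < n) c k * x ^+ k <= gen_fun c x.
Proof.
move=> hc c0 /[dup] x01 /andP[x0 x1].
apply: nondecreasing_cvgn_le; last exact: cvg_pseries hc (norm01 x01).
by apply/nondecreasing_series => k _ _; rewrite mulr_ge0// exprn_ge0.
Qed.

Lemma gen_fun_ge (x : R) : 0 <= x < 1 -> expR (expR 1) <= gen_fun b x.
Proof.
move=> x01; apply: le_trans b0 _.
have := partial_sum_le_gen_fun 1 b_bounded b_ge0 x01.
by rewrite big_nat1 expr0 mulr1.
Qed.

Let gen_fun_gt0 (x : R) : 0 <= x < 1 -> 0 < gen_fun b x.
Proof. by move=> /gen_fun_ge; apply: lt_le_trans; exact: expR_gt0. Qed.

Let gen_fun_ge0 (c : nat -> R) (x : R) : disk_bounded c -> (forall n, 0 <= c n) ->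
  0 <= x < 1 -> 0 <= gen_fun c x.
Proof.
by move=> hc c0 x01; have := partial_sum_le_gen_fun 0 hc c0 x01; rewrite big_nil.
Qed.

Lemma gen_mean_ge0 (x : R) : 0 <= x < 1 -> 0 <= gen_mean x.
Proof.
move=> /[dup] x01 /andP[x0 x1]; apply: divr_ge0; last exact: ltW (gen_fun_gt0 x01).
by apply: mulr_ge0 => //; exact: gen_fun_ge0.
Qed.

Let cvg0 (x : R) : 0 <= x < 1 ->
  (fun n => \sum_(0 <= k < n) b k * x ^+ k) @ \oo --> gen_fun b x.
Proof. by move=> x01; exact: (cvg_pseries b_bounded (norm01 x01)). Qed.

Let cvg1 (x : R) : 0 <= x < 1 ->
  (fun n => \sum_(0 <= k < n) k%:R * (b k * x ^+ k)) @ \oo --> x * gen_fun b1 x.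
Proof.
move=> x01; rewrite -cvg_shiftS.
rewrite (_ : (fun n => _) = (fun n => x * pseries b1 x n)).
  exact: (cvgM (cvg_cst x) (cvg_pseries hd1 (norm01 x01))).
apply/funext => n /=; rewrite big_nat_recl//= mul0r add0r mulr_sumr.
by apply: eq_bigr => k _; rewrite /b1 /pseries_diffs exprS/=; ring.
Qed.

(** Write [k^2 = k + k (k-1)]: the derivatives of the generating function give factorial moments. *)
Let cvg2 (x : R) : 0 <= x < 1 ->
  (fun n => \sum_(0 <= k < n) k%:R ^+ 2 * (b k * x ^+ k)) @ \oo -->
  x * gen_fun b1 x + x ^+ 2 * gen_fun b2 x.
Proof.
move=> x01.
have c2 : (fun n => \sum_(0 <= k < n) (k%:R * (k%:R - 1)) * (b k * x ^+ k)) @ \oo -->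
    x ^+ 2 * gen_fun b2 x.
  rewrite -cvg_shiftS -cvg_shiftS.
  rewrite (_ : (fun n => _) = (fun n => x ^+ 2 * pseries b2 x n)).
    exact: (cvgM (cvg_cst (x ^+ 2)) (cvg_pseries hd2 (norm01 x01))).
  apply/funext => n /=; rewrite 2?big_nat_recl//= mul0r subrr mulr0 !mul0r !add0r mulr_sumr.
  by apply: eq_bigr => k _; rewrite /b2 /b1 /pseries_diffs /= !exprS -!natr1; ring.
rewrite (_ : (fun n => _) = (fun n => \sum_(0 <= k < n) k%:R * (b k * x ^+ k) +
    \sum_(0 <= k < n) (k%:R * (k%:R - 1)) * (b k * x ^+ k))).
  exact: cvgD (cvg1 x01) c2.
by apply/funext => n; rewrite -big_split/=; apply: eq_bigr => k _; ring.
Qed.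

Let cvg_var (x : R) : 0 <= x < 1 ->
  (fun n => \sum_(0 <= k < n) (k%:R - gen_mean x) ^+ 2 * (b k * x ^+ k)) @ \oo -->
  gen_var x * gen_fun b x.
Proof.
move=> x01; set m := gen_mean x.
have G0 : gen_fun b x != 0 by rewrite gt_eqF// gen_fun_gt0.
have mE : x * gen_fun b1 x = m * gen_fun b x by rewrite /m /gen_mean divfK.
have -> : gen_var x * gen_fun b x = (x * gen_fun b1 x + x ^+ 2 * gen_fun b2 x) -
    (2 * m) * (x * gen_fun b1 x) + m ^+ 2 * gen_fun b x.
  by rewrite /gen_var -/m mulrBl divfK// mE; ring.
rewrite (_ : (fun n => _) = (fun n => \sum_(0 <= k < n) k%:R ^+ 2 * (b k * x ^+ k) -
   (2 * m) * \sum_(0 <= k < n) k%:R * (b k * x ^+ k) +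
   m ^+ 2 * \sum_(0 <= k < n) b k * x ^+ k)).
  apply: (cvgD (cvgB (cvg2 x01) _) _).
    exact: (cvgM (cvg_cst (2 * m)) (cvg1 x01)).
  exact: (cvgM (cvg_cst (m ^+ 2)) (cvg0 x01)).
apply/funext => n; rewrite !mulr_sumr -sumrB -big_split/=; apply: eq_bigr => k _.
by ring.
Qed.

Let partial_le_lim (w : nat -> R) (l : R) n : (forall k, 0 <= w k) ->
  (fun n => \sum_(0 <= k < n) w k) @ \oo --> l -> \sum_(0 <= k < n) w k <= l.
Proof.
move=> w0 wl; rewrite -(cvg_lim _ wl)//.
have cw : cvgn (fun n => \sum_(0 <= k < n) w k) by apply/cvg_ex; exists l.
by apply: (nondecreasing_cvgn_le _ cw); apply/nondecreasing_series => k _ _.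
Qed.

Let w_ge0 (x : R) k : 0 <= x < 1 -> 0 <= b k * x ^+ k.
Proof. by move=> /andP[x0 _]; rewrite mulr_ge0// exprn_ge0. Qed.

Lemma gen_var_ge0 (x : R) : 0 <= x < 1 -> 0 <= gen_var x.
Proof.
move=> x01; rewrite -(pmulr_lge0 _ (gen_fun_gt0 x01)).
have := @partial_le_lim (fun k => (k%:R - gen_mean x) ^+ 2 * (b k * x ^+ k)) _ 0.
rewrite big_nil; apply; last exact: cvg_var.
by move=> k; rewrite mulr_ge0 ?sqr_ge0 ?w_ge0.
Qed.

Lemma second_moment_le (x : R) n : 0 <= x < 1 ->
  \sum_(0 <= k < n) k%:R ^+ 2 * (b k * x ^+ k) <=
    gen_fun b x * (gen_var x + gen_mean x ^+ 2).
Proof.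
move=> x01; have G0 : gen_fun b x != 0 by rewrite gt_eqF// gen_fun_gt0.
rewrite /gen_var subrK mulrC divfK//.
apply: partial_le_lim; last exact: cvg2.
by move=> k; rewrite mulr_ge0 ?sqr_ge0 ?w_ge0.
Qed.

Lemma count_near_le (m t : R) n : 0 <= t ->
  \sum_(0 <= k < n) (`|k%:R - m| < t)%R%:R <= 2 * t + 1 :> R.
Proof.
(* The clamped shift F increases by 1 at every counted index. *)
move=> t0; pose F (x : R) := Num.min (Num.max (x - (m - t)) 0) (2 * t + 1).
have F1 x : F x <= 2 * t + 1 by rewrite /F ge_min lexx orbT.
have F0 x : 0 <= F x.
  by rewrite /F le_min le_max lexx orbT/= addr_ge0// mulr_ge0.
suff : \sum_(0 <= k < n) (`|k%:R - m| < t)%R%:R <= F n%:R - F 0.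
  by move=> /le_trans; apply; rewrite lerBlDr ler_wpDr.
elim: n => [|n IH]; first by rewrite big_nil subrr.
rewrite big_nat_recr//=; apply: le_trans (lerD IH (lexx _)) _.
rewrite addrAC lerD2r -natr1; case: ltP => h; rewrite ?addr0.
  move: h; rewrite ltr_norml => /andP[h1 h2].
  rewrite /F !max_l; [|lra|lra].
  rewrite !min_l; [|lra|lra].
  by rewrite mulr1n; lra.
rewrite [leRHS]/F le_min F1 andbT.
apply: (@le_trans _ _ (Num.max (n%:R - (m - t)) 0)); first by rewrite /F ge_min lexx.
by rewrite ge_max !le_max lexx orbT andbT; apply/orP; left; lra.
Qed.

(** With [t^2 = 2 s + 1], Chebyshev's inequality leaves at most half of the mass at [|k - m| >= t];
    the at most [2 t + 1] remaining indices contribute at most [mu] each. The [+ 1] in [t^2] keeps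
    [t] positive when the variance vanishes. *)
Lemma gen_fun_chebyshev (x mu : R) : 0 <= x < 1 -> (forall n, b n * x ^+ n <= mu) ->
  gen_fun b x <= 2 * (2 * Num.sqrt (2 * gen_var x + 1) + 1) * mu.
Proof.
move=> x01 Hmu; set m := gen_mean x; set s := gen_var x; set G := gen_fun b x.
have s0 : 0 <= s := gen_var_ge0 x01.
pose la := 2 * s + 1; have la0 : 0 < la by rewrite /la; lra.
pose t := Num.sqrt la; have t0 : 0 < t by rewrite sqrtr_gt0.
have t2 : t ^+ 2 = la by rewrite sqr_sqrtr// ltW.
have mu0 : 0 <= mu by apply: le_trans (Hmu 0%N); exact: w_ge0.
have part n : \sum_(0 <= k < n) b k * x ^+ k <= (2 * t + 1) * mu + G / 2.
  apply: (@le_trans _ _ (\sum_(0 <= k < n) ((`|k%:R - m| < t)%R%:R * mu +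
     (k%:R - m) ^+ 2 * (b k * x ^+ k) / la))).
    apply: ler_sum => k _; case: ltP => h.
      rewrite mul1r; apply: ler_wpDr => //.
      apply: divr_ge0; last exact: ltW.
      by apply: mulr_ge0; [exact: sqr_ge0|exact: w_ge0].
    rewrite mul0r add0r ler_pdivlMr// mulrC; apply: ler_wpM2r; first exact: w_ge0.
    by rewrite -t2 -[leRHS]real_normK ?num_real// lerXn2r ?nnegrE ?(ltW t0).
  rewrite big_split/= -!mulr_suml; apply: lerD.
    by apply: ler_wpM2r => //; apply: count_near_le; exact: ltW.
  rewrite ler_pdivrMr//.
  have := @partial_le_lim (fun k => (k%:R - m) ^+ 2 * (b k * x ^+ k)) _ n.
  move=> /(_ _ _ (cvg_var x01)) /le_trans; apply.
    by move=> k; apply: mulr_ge0; [exact: sqr_ge0|exact: w_ge0].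
  rewrite -/s -/G /la.
  have G0 : 0 < G := gen_fun_gt0 x01.
  by nra.
have : G <= (2 * t + 1) * mu + G / 2.
  have G_lim := cvg0 x01.
  rewrite {1}/G -(cvg_lim _ G_lim)//; apply: limr_le.
    by apply/cvg_ex; eexists; exact: G_lim.
  by apply: nearW => n; exact: part.
by rewrite /t /la; move: (Num.sqrt _) => y hy; lra.
Qed.

(** * Growth of the mean and the variance outside a small set *)

Section exceptional_set.
Variable e : R.
Hypothesis e0 : 0 < e.

(** Functions of [r] with [x = r^2], since the coefficients are squared moduli; [v] and [h'] are the
    derivatives of [u] and [h], and [g'] is that of the mean in [x]. The summand [expR 1] gives
    [ln h >= 1], as the growth lemma requires. *)
Let u (r : R) := ln (gen_fun b (r ^+ 2)).
Let v (r : R) := 2 * r * gen_fun b1 (r ^+ 2) / gen_fun b (r ^+ 2).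
Let h (r : R) := expR 1 + gen_mean (r ^+ 2).
Let g' (x : R) := (gen_fun b1 x + x * gen_fun b2 x) / gen_fun b x -
  x * gen_fun b1 x ^+ 2 / gen_fun b x ^+ 2.
Let h' (r : R) := 2 * r * g' (r ^+ 2).

Let sqr01 (r : R) : -1 < r < 1 -> 0 <= r ^+ 2 < 1.
Proof.
move=> /andP[r1 r2]; rewrite sqr_ge0/=; nra.
Qed.

Let d_sqr (r : R) : is_derive r (1 : R) (fun r : R => r ^+ 2) (2 * r).
Proof.
have d1 := is_derive_id r (1 : R).
rewrite (_ : (fun r : R => r ^+ 2) = id * id); last first.
  by apply/funext => y; rewrite expr2.
by apply: is_derive_eq (is_deriveM d1 d1) _; rewrite /GRing.scale/= mulr1 mulr_natl.
Qed.

Let du (r : R) : -1 < r < 1 -> is_derive r (1 : R) u (v r).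
Proof.
move=> /sqr01 x01.
have d1 := is_derive_gen_fun b_bounded (norm01 x01).
have d2 := @is_derive1_comp _ (gen_fun b) (fun r : R => r ^+ 2) r _ _ d1 (d_sqr r).
have d3 : is_derive ((gen_fun b \o (fun r : R => r ^+ 2)) r) (1 : R) (@ln R) _ :=
  is_derive1_ln (gen_fun_gt0 x01).
have d4 := is_derive1_comp d3 d2.
have -> : v r = (gen_fun b (r ^+ 2))^-1 * (gen_fun (pseries_diffs b) (r ^+ 2) * (2 * r)).
  by rewrite /v -/b1; ring.
exact: d4.
Qed.

Let d_mean (x : R) : 0 <= x < 1 -> is_derive x (1 : R) gen_mean (g' x).
Proof.
move=> x01; have G0 := gen_fun_gt0 x01.
have d0 := is_derive_gen_fun b_bounded (norm01 x01).
have d1 := is_derive_gen_fun hd1 (norm01 x01).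
have dn := is_deriveM (is_derive_id x (1 : R)) d1.
have di := is_deriveV (lt0r_neq0 G0) d0.
rewrite (_ : gen_mean = (id * gen_fun b1) * (fun y => (gen_fun b y)^-1)); last first.
  by apply/funext.
apply: is_derive_eq (is_deriveM dn di) _.
rewrite /GRing.scale/= /g' -/b1 -/b2.
have -> : (id * gen_fun b1) x = x * gen_fun b1 x by [].
by field; rewrite gt_eqF.
Qed.

Let dh (r : R) : -1 < r < 1 -> is_derive r (1 : R) h (h' r).
Proof.
move=> /sqr01 x01.
have dc := @is_derive1_comp _ gen_mean (fun r : R => r ^+ 2) r _ _ (d_mean x01) (d_sqr r).
have dd := is_deriveD (is_derive_cst (expR 1) r (1 : R)) dc.
by apply: is_derive_eq dd _; rewrite add0r mulrC.
Qed.

Let continuous_sqr_gen (c : nat -> R) (r : R) : disk_bounded c -> -1 < r < 1 ->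
  {for r, continuous (fun r : R => gen_fun c (r ^+ 2))}.
Proof.
move=> hc /sqr01 /norm01 x1.
apply: (@continuous_comp _ _ _ (fun r : R => r ^+ 2) (gen_fun c)).
  have [d _] := d_sqr r; exact/differentiable_continuous/derivable1_diffP.
exact: continuous_gen_fun.
Qed.

Let c2r (r : R) : {for r, continuous (fun r : R => 2 * r)}.
Proof. by apply: continuousM; [exact: cst_continuous|exact: cvg_id]. Qed.

Let csqr (r : R) : {for r, continuous (fun r : R => r ^+ 2)}.
Proof. by have [d _] := d_sqr r; exact/differentiable_continuous/derivable1_diffP. Qed.

Let cinv (r : R) : -1 < r < 1 -> {for r, continuous (fun r : R => (gen_fun b (r ^+ 2))^-1)}.
Proof.
move=> r1; apply: continuousV; last exact: continuous_sqr_gen.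
by rewrite gt_eqF// gen_fun_gt0// sqr01.
Qed.

Let cv (r : R) : -1 < r < 1 -> {for r, continuous v}.
Proof.
move=> r1; apply: continuousM; last exact: cinv.
by apply: continuousM; [exact: c2r|exact: continuous_sqr_gen].
Qed.

Let ch' (r : R) : -1 < r < 1 -> {for r, continuous h'}.
Proof.
move=> r1; apply: continuousM; first exact: c2r.
have c1 := continuous_sqr_gen hd1 r1; have c2 := continuous_sqr_gen hd2 r1.
apply: continuousB.
  apply: continuousM; last exact: cinv.
  by apply: continuousD => //; apply: continuousM => //; exact: csqr.
rewrite (_ : (fun r => _) = (fun r : R => r ^+ 2 * (gen_fun b1 (r ^+ 2) * gen_fun b1 (r ^+ 2))
   * ((gen_fun b (r ^+ 2))^-1 * (gen_fun b (r ^+ 2))^-1))).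
  apply: continuousM; last by apply: continuousM; exact: cinv.
  by apply: continuousM; [exact: csqr|exact: continuousM].
by apply/funext => y; rewrite (expr2 (gen_fun b1 _)) (expr2 (gen_fun b _)) invfM.
Qed.

(** For weights proportional to [b_n x^n] the variance is [x] times the derivative of the mean; here
    [x = r^2]. *)
Let var_deriv (r : R) : 0 < r < 1 -> gen_var (r ^+ 2) = r / 2 * h' r.
Proof.
move=> /andP[r0 r1]; have r11 : -1 < r < 1 by rewrite r1 andbT; lra.
have G0 := gen_fun_gt0 (sqr01 r11).
by rewrite /gen_var /gen_mean /h' /g'; field; rewrite gt_eqF.
Qed.

Let in01 (r : R) : 0 <= r < 1 -> -1 < r < 1.
Proof. by move=> /andP[r0 ->]; rewrite andbT; lra. Qed.

Let v_ge0 (r : R) : 0 <= r < 1 -> 0 <= v r.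
Proof.
move=> /[dup] /andP[r0 _] /in01 /sqr01 x01; apply: divr_ge0.
  by apply: mulr_ge0; [exact: mulr_ge0|exact: gen_fun_ge0].
exact: ltW (gen_fun_gt0 x01).
Qed.

Let h'_ge0 (r : R) : 0 <= r < 1 -> 0 <= h' r.
Proof.
move=> /[dup] /andP[r0 r1] r01; move: r0; rewrite le_eqVlt => /orP[/eqP <-|r0].
  by rewrite /h' mulr0 mul0r.
have := gen_var_ge0 (sqr01 (in01 r01)); rewrite var_deriv ?r0//.
by rewrite pmulr_rge0// divr_gt0.
Qed.

Let u_ge (r : R) : -1 < r < 1 -> expR 1 <= u r.
Proof.
move=> /sqr01 x01; rewrite -[leLHS]expRK ler_ln ?posrE ?expR_gt0 ?gen_fun_gt0//.
exact: gen_fun_ge.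
Qed.

Let h_ge (r : R) : -1 < r < 1 -> expR 1 <= h r.
Proof. by move=> /sqr01 x01; rewrite /h lerDl; exact: gen_mean_ge0. Qed.

(** The mean is [r/2] times [v r] and the variance [r/2] times [h' r]; the factor [r/2 <= 1] is
    dropped. *)
Lemma moments_growth : exists E : set R,
  [/\ measurable E, E `<=` `[0, 1[%classic, finite_log_measure E &
    forall r : R, 0 < r < 1 -> ~ E r ->
      let u := ln (gen_fun b (r ^+ 2)) in
      let h := expR 1 + gen_mean (r ^+ 2) in
      gen_mean (r ^+ 2) <= u * ln u `^ (1 + e) / (1 - r) /\
      gen_var (r ^+ 2) <= h * ln h `^ (1 + e) / (1 - r)].
Proof.
pose E1 := growth_exceptional_set u v e; pose E2 := growth_exceptional_set h h' e.
have mE1 : measurable E1 by apply: measurable_growth_exceptional_set.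
have mE2 : measurable E2 by apply: measurable_growth_exceptional_set.
have E101 : E1 `<=` `[0, 1[%classic by move=> r [].
have E201 : E2 `<=` `[0, 1[%classic by move=> r [].
have fE1 : finite_log_measure E1 by apply: finite_log_measure_growth_exceptional_set.
have fE2 : finite_log_measure E2 by apply: finite_log_measure_growth_exceptional_set.
exists (E1 `|` E2); split.
- exact: measurableU.
- by move=> r [/E101|/E201].
- exact: finite_log_measureU.
move=> r /andP[r0 r1] Er U H.
have r01 : 0 <= r < 1 by rewrite r1 ltW.
have d0 : 0 < 1 - r by rewrite subr_gt0.
have v0 := v_ge0 r01; have h0 := h'_ge0 r01.
have {}Er1 : (1 - r) * v r <= u r * ln (u r) `^ (1 + e).
  by rewrite leNgt; apply/negP => h3; apply: Er; left; split.
have Er2 : (1 - r) * h' r <= h r * ln (h r) `^ (1 + e).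
  by rewrite leNgt; apply/negP => h3; apply: Er; right; split.
rewrite !ler_pdivlMr//; split.
  apply: le_trans Er1; rewrite mulrC; apply: ler_wpM2l; first exact: ltW.
  have -> : gen_mean (r ^+ 2) = r / 2 * v r.
    by rewrite /gen_mean /v; field; rewrite gt_eqF// gen_fun_gt0// sqr01// in01.
  by apply: ler_piMl => //; lra.
apply: le_trans Er2; rewrite mulrC; apply: ler_wpM2l; first exact: ltW.
rewrite var_deriv ?r0//.
by apply: ler_piMl => //; lra.
Qed.

End exceptional_set.
End power_series_moments.

(** * Estimates outside the exceptional set *)

Section estimate.
Context (R : realType).
Variables (delta e C0 r u m s mu : R).
Hypothesis e0 : 0 < e.
Hypothesis e1 : e <= 1.
Hypothesis edelta : e <= delta.
Hypothesis C01 : 1 <= C0.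
Hypothesis r1 : r < 1.
Hypothesis mu0 : 0 < mu.
Hypothesis m0 : 0 <= m.
Hypothesis s0 : 0 <= s.
Hypothesis u_ge : expR 1 <= u.

(** Only numbers remain in this section: [u], [m], [s], [mu] are the values at one [r] outside the
    exceptional set. All of [D], [L], [u], [U] are at least 1, so sums can be bounded by
    products. *)
Let D := (1 - r)^-1.
Let L := ln D.
Let La := ln (mu / (1 - r)).
Let U := ln u.
Let h := expR 1 + m.

Hypothesis L1 : 1 <= ln (1 - r)^-1.
Hypothesis m_le : m <= u * ln u `^ (1 + e) / (1 - r).
Hypothesis s_le : s <= (expR 1 + m) * ln (expR 1 + m) `^ (1 + e) / (1 - r).
Hypothesis u_le : expR u <= 2 * (2 * Num.sqrt (2 * s + 1) + 1) * (C0 * mu ^+ 2).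

Let D0 : 0 < D.
Proof. by rewrite invr_gt0 subr_gt0. Qed.

Let u1 : 1 <= u.
Proof. by apply: le_trans u_ge; apply: le_trans (expR_ge1Dx _); rewrite lerDl. Qed.

Let u0 : 0 < u.
Proof. exact: lt_le_trans u1. Qed.

Let U1 : 1 <= U.
Proof. by rewrite /U -[leLHS]expRK ler_ln ?posrE ?expR_gt0. Qed.

Let D1 : 1 <= D.
Proof.
rewrite -[leRHS](@lnK _ D) ?posrE// -/L; apply: le_trans (expR_ge1Dx _).
by rewrite lerDl; apply: le_trans L1.
Qed.

Let L0 : 0 < L.
Proof. exact: lt_le_trans L1. Qed.

Let U0 : 0 < U.
Proof. exact: lt_le_trans U1. Qed.

Let ln_le_sub1 (x : R) : 0 < x -> ln x <= x - 1.
Proof.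
move=> x0; have := @le_ln1Dx R (x - 1).
by rewrite (_ : 1 + (x - 1) = x); [apply; lra|ring].
Qed.

(** From [ln x = 2 ln (sqrt x) <= 2 sqrt x]. *)
Let ln_sqr_le (x : R) : 1 <= x -> ln x ^+ 2 <= 4 * x.
Proof.
move=> x1; have x0 : 0 < x by exact: lt_le_trans x1.
have sx0 : 0 < Num.sqrt x by rewrite sqrtr_gt0.
have := ln_le_sub1 sx0.
have E : ln x = 2 * ln (Num.sqrt x).
  by rewrite -{1}(sqr_sqrtr (ltW x0)) lnXn// mulr_natl.
have l0 : 0 <= ln x by exact: ln_ge0.
move=> H; have H2 : ln x <= 2 * Num.sqrt x by lra.
apply: (@le_trans _ _ ((2 * Num.sqrt x) ^+ 2)); last first.
  by rewrite exprMn sqr_sqrtr ?(ltW x0)// -natrX.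
by rewrite lerXn2r ?nnegrE// mulr_ge0// ltW.
Qed.

Let powR1e_le (x : R) : 1 <= x -> x `^ (1 + e) <= x ^+ 2.
Proof.
move=> x1; rewrite -powR_mulrn; last exact: le_trans x1.
have e2 : 1 + e <= 2 :> R by move: e1; lra.
exact: ler_powR.
Qed.

Let powR_ge1 (x y : R) : 1 <= x -> 0 <= y -> 1 <= x `^ y.
Proof. by move=> x1 y0; rewrite -(powRr0 x); exact: ler_powR. Qed.

Let X := U `^ (1 + e).
Let Y := L `^ (1 + e).

Let e_ge0 : 0 <= 1 + e.
Proof. by rewrite addr_ge0 ?ltW. Qed.

Let X1 : 1 <= X.
Proof. exact: powR_ge1. Qed.

Let Y1 : 1 <= Y.
Proof. exact: powR_ge1. Qed.

Let X_le : X <= 4 * u.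
Proof. by apply: le_trans (powR1e_le U1) _; exact: ln_sqr_le. Qed.

Let Y_le : Y <= 4 * D.
Proof. by apply: le_trans (powR1e_le L1) _; exact: ln_sqr_le. Qed.

Let mE : m <= u * X * D.
Proof. exact: m_le. Qed.

Let h_le : h <= 2 * (u * X * D).
Proof.
have : u <= u * X * D.
  rewrite -mulrA ler_peMr ?(ltW u0)//; rewrite -[leLHS]mulr1.
  by apply: ler_pM.
by rewrite /h; have := mE; have := u_ge; lra.
Qed.

(** With [X <= 4 u] one gets [h <= 8 u^2 D], so [ln h <= 3 + 2 U + L]. *)
Let lnh_le : ln h <= 6 * (L * U).
Proof.
have h0 : 0 < h by rewrite /h ltr_pwDl// expR_gt0.
have h8 : h <= 8 * u ^+ 2 * D.
  apply: le_trans h_le _.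
  have -> : 2 * (u * X * D) = 2 * u * D * X by ring.
  have -> : 8 * u ^+ 2 * D = 2 * u * D * (4 * u) by ring.
  by apply: ler_wpM2l => //; rewrite !mulr_ge0 ?(ltW u0) ?(ltW D0).
apply: (@le_trans _ _ (ln (8 * u ^+ 2 * D))).
  by rewrite ler_ln ?posrE// !mulr_gt0 ?exprn_gt0.
rewrite !lnM ?posrE ?mulr_gt0 ?exprn_gt0// -/U -/L.
have l8 : ln 8 <= 3 :> R.
  rewrite -[3]expRK ler_ln ?posrE ?expR_gt0//.
  have -> : (3 : R) = 1 + 1 + 1 by ring.
  rewrite !expRD; have := expR_ge1Dx (1 : R) => H.
  have H2 : 4 <= expR (1 : R) * expR 1 by nra.
  by nra.
by have := L1; have := U1; rewrite -/D -/L; nra.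
Qed.

(** Here 72 is [2 * 36], and 36 bounds [6^(1+e)]. The powers of [X] and [Y] are kept as they are,
    because they decide the exponents of the final estimate. *)
Let s_bound : s <= 72 * (D ^+ 2 * u * X ^+ 2 * Y).
Proof.
have lnh1 : 1 <= ln h.
  have := expR_gt0 (1 : R) => ee; rewrite -[leLHS](expRK (1 : R)) ler_ln ?posrE//.
    by rewrite /h lerDl.
  by rewrite /h ltr_pwDl.
apply: le_trans s_le _; rewrite -/D -/h.
have H : ln h `^ (1 + e) <= 36 * (Y * X).
  apply: (@le_trans _ _ ((6 * (L * U)) `^ (1 + e))).
    by apply: ge0_ler_powR; rewrite ?nnegrE//;
     [exact: le_trans lnh1|rewrite !mulr_ge0 ?(ltW L0) ?(ltW U0)].
  rewrite !powRM ?mulr_ge0 ?(ltW L0) ?(ltW U0)// -/X -/Y.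
  apply: ler_wpM2r; first by rewrite mulr_ge0//; [apply: le_trans Y1|apply: le_trans X1].
  apply: le_trans (powR1e_le _) _; first by rewrite ler1n.
  by rewrite -natrX.
have X0 : 0 < X by exact: lt_le_trans X1.
have Y0 : 0 < Y by exact: lt_le_trans Y1.
apply: (@le_trans _ _ (2 * (u * X * D) * (36 * (Y * X)) * D)); last first.
  by rewrite le_eqVlt; apply/orP; left; apply/eqP; ring.
apply: ler_wpM2r; first exact: ltW.
apply: ler_pM; [by rewrite /h addr_ge0// expR_ge0|exact: powR_ge0|exact: h_le|exact: H].
Qed.

(** The square root of [D^2 u X^2 Y], the majorant of [s] up to a constant. *)
Let T := D * Num.sqrt u * X * Num.sqrt Y.

Let T1 : 1 <= T.
Proof.
have sq1 (x : R) : 1 <= x -> 1 <= Num.sqrt x.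
  by move=> x1; rewrite -[leLHS]sqrtr1 ler_sqrt// (le_trans _ x1).
have a1 := sq1 _ u1; have a2 := sq1 _ Y1.
by rewrite /T !mulr_ege1.
Qed.

(** Since [T >= 1], [2 s + 1 <= 144 T^2 + 1 <= (13 T)^2], and [2 (2 * 13 T + 1) <= 54 T]. *)
Let expu_le : expR u <= 54 * C0 * mu ^+ 2 * T.
Proof.
apply: le_trans u_le _.
have T0 : 0 <= T by exact: le_trans T1.
have sq : Num.sqrt (2 * s + 1) <= 13 * T.
  have -> : 13 * T = Num.sqrt ((13 * T) ^+ 2).
    by rewrite sqrtr_sqr ger0_norm// mulr_ge0.
  rewrite ler_sqrt ?sqr_ge0//.
  have -> : (13 * T) ^+ 2 = 169 * (D ^+ 2 * u * X ^+ 2 * Y).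
    rewrite /T !exprMn !sqr_sqrtr ?(ltW u0)// ?(le_trans _ Y1)//; ring.
  have := s_bound; have : 1 <= D ^+ 2 * u * X ^+ 2 * Y.
    by rewrite !mulr_ege1// exprn_ege1.
  by lra.
have C0m : 0 <= C0 * mu ^+ 2 by rewrite mulr_ge0 ?sqr_ge0// (le_trans _ C01).
apply: (@le_trans _ _ (54 * T * (C0 * mu ^+ 2))); last first.
  by rewrite le_eqVlt; apply/orP; left; apply/eqP; ring.
by apply: ler_wpM2r => //; have := T1; lra.
Qed.

Let lnT : ln T = L + U / 2 + (1 + e) * ln U + (1 + e) / 2 * ln L.
Proof.
have X0 : 0 < X by exact: lt_le_trans X1.
have Y0 : 0 < Y by exact: lt_le_trans Y1.
rewrite /T !lnM ?posrE ?mulr_gt0 ?sqrtr_gt0//.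
rewrite -!powR12_sqrt ?(ltW u0) ?(ltW Y0)// !ln_powR -/L -/U; ring.
Qed.

Hypothesis La_ge : 2 * ln (54 * C0) + 5 <= ln (mu / (1 - r)).
Hypothesis lnLa1 : 1 <= ln (ln (mu / (1 - r))).

Let LaE : La = ln mu + L.
Proof. by rewrite /La lnM ?posrE. Qed.

Let ln5_le : ln 5 <= 2 :> R.
Proof.
rewrite -[2]expRK ler_ln ?posrE ?expR_gt0//.
have hx := expR_ge1Dx (2^-1 : R).
have -> : (2 : R) = 2^-1 + 2^-1 + (2^-1 + 2^-1) by field.
rewrite (expRD (_ + _)) expRD; move: (expR _) hx => x hx.
have hx1 : 3 / 2 <= x by lra.
have x2 : 9 / 4 <= x * x.
  by apply: (@le_trans _ _ (3 / 2 * (3 / 2))); [lra|apply: ler_pM => //; lra].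
by apply: (@le_trans _ _ (9 / 4 * (9 / 4))); [lra|apply: ler_pM => //; lra].
Qed.

(** Logarithms in the bound of [expR u] give [u <= ln (54 C0) + 2 La + (5/2) U]. Because
    [U <= u/5 + 1], the last term is at most [u/2 + 5/2], so [u <= 2 ln (54 C0) + 5 + 4 La]; [La_ge]
    absorbs the constant. *)
Let u_le_La : u <= 5 * La.
Proof.
have T0 : 0 < T by exact: lt_le_trans T1.
have C00 : 0 < C0 by exact: lt_le_trans C01.
have H : u <= ln (54 * C0) + 2 * ln mu + ln T.
  rewrite -[leLHS]expRK; apply: (@le_trans _ _ (ln (54 * C0 * mu ^+ 2 * T))).
    rewrite ler_ln; [exact: expu_le|by rewrite posrE expR_gt0|].
    by rewrite posrE; apply: mulr_gt0 T0; apply: mulr_gt0 (exprn_gt0 2 mu0); exact: mulr_gt0.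
  have p1 : 0 < 54 * C0 by exact: mulr_gt0.
  have p2 : 0 < mu ^+ 2 by exact: exprn_gt0.
  have -> : ln (54 * C0 * mu ^+ 2 * T) = ln (54 * C0 * mu ^+ 2) + ln T.
    by rewrite lnM ?posrE ?(mulr_gt0 p1 p2).
  have -> : ln (54 * C0 * mu ^+ 2) = ln (54 * C0) + ln (mu ^+ 2) by rewrite lnM ?posrE.
  by rewrite lnXn// [2 * ln mu]mulr_natl.
have lU : ln U <= U - 1 := ln_le_sub1 U0.
have lL : ln L <= L - 1 := ln_le_sub1 L0.
have lU0 : 0 <= ln U by exact: ln_ge0.
have lL0 : 0 <= ln L by exact: ln_ge0.
have U5 : U <= u / 5 + 1.
  have h5 : 0 < u / 5 by rewrite divr_gt0.
  have := ln_le_sub1 h5; rewrite ln_div ?posrE// -/U.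
  have := ln5_le; lra.
have e2 : (1 + e) * ln U <= 2 * U.
  apply: (@le_trans _ _ (2 * ln U)); last by lra.
  by apply: ler_wpM2r => //; move: e1; lra.
have e3 : (1 + e) / 2 * ln L <= L.
  apply: (@le_trans _ _ (1 * ln L)); last by lra.
  by apply: ler_wpM2r => //; move: e1; lra.
move: H La_ge; rewrite lnT -/La LaE; lra.
Qed.

Let La0 : 0 < La.
Proof. by have := u_le_La; have := u0; lra. Qed.

(** Only the logarithm matters, so the crude [X <= 4 u] and [Y <= 4 D] suffice: they give
    [q <= K D^3 u^4], where [72 * 64], 16 and 1 come from [s], [m^2] and 1, and [N + 2 <= 3 q^2].
    The 7 is [3 + 4], the exponents of [D] and [u]. *)
Lemma degree_estimate N : N.+1%:R <= (2 * (s + m ^+ 2 + 1)) ^+ 2 + 1 ->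
  ln N.+2%:R <= (ln 3 + 2 * (ln (2 * (72 * 64 + 17)) + 7)) * (ln (1 - r)^-1 * ln u).
Proof.
set K : R := 2 * (72 * 64 + 17).
have K1 : 1 <= K by rewrite /K; lra.
have K0 : 0 < K by exact: lt_le_trans K1.
rewrite -/D -/L -/U => HN; set q := 2 * (s + m ^+ 2 + 1) in HN.
have m2 : 0 <= m ^+ 2 by rewrite sqr_ge0.
have q1 : 1 <= q by rewrite /q; have := s0; lra.
have q0 : 0 < q by exact: lt_le_trans q1.
have X0 : 0 < X by exact: lt_le_trans X1.
have Y0 : 0 < Y by exact: lt_le_trans Y1.
have XX : X ^+ 2 <= 16 * u ^+ 2.
  have -> : 16 * u ^+ 2 = (4 * u) ^+ 2 by rewrite exprMn -natrX.
  by rewrite lerXn2r ?nnegrE ?mulr_ge0 ?(ltW u0) ?(ltW X0).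
have uD : 1 <= u * D by rewrite mulr_ege1.
have q_le : q <= K * (D ^+ 3 * u ^+ 4).
  have H1 : D ^+ 2 * u * X ^+ 2 * Y <= 64 * (D ^+ 3 * u ^+ 4).
    apply: (@le_trans _ _ (D ^+ 2 * u * (16 * u ^+ 2) * (4 * D))).
      apply: ler_pM; [|exact: ltW| |exact: Y_le].
        by rewrite !mulr_ge0 ?exprn_ge0 ?(ltW u0) ?(ltW D0) ?(ltW X0).
      by apply: ler_wpM2l => //; rewrite mulr_ge0 ?exprn_ge0 ?(ltW u0) ?(ltW D0).
    have -> : D ^+ 2 * u * (16 * u ^+ 2) * (4 * D) = 64 * (D ^+ 3 * u ^+ 3) by ring.
    apply: ler_wpM2l => //; apply: ler_wpM2l; first by rewrite exprn_ge0 ?(ltW D0).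
    by rewrite ler_weXn2l.
  have H2 : m ^+ 2 <= 16 * (D ^+ 3 * u ^+ 4).
    apply: (@le_trans _ _ ((u * X * D) ^+ 2)).
      by rewrite lerXn2r ?nnegrE// !mulr_ge0 ?(ltW u0) ?(ltW D0) ?(ltW X0).
    rewrite !exprMn.
    apply: (@le_trans _ _ (u ^+ 2 * (16 * u ^+ 2) * D ^+ 2)).
      by apply: ler_wpM2r; rewrite ?ler_wpM2l ?exprn_ge0 ?(ltW D0) ?(ltW u0).
    have -> : u ^+ 2 * (16 * u ^+ 2) * D ^+ 2 = 16 * (D ^+ 2 * u ^+ 4) by ring.
    apply: ler_wpM2l => //; apply: ler_wpM2r; first by rewrite exprn_ge0 ?(ltW u0).
    by rewrite ler_weXn2l.
  have H3 : 1 <= D ^+ 3 * u ^+ 4 by rewrite mulr_ege1// exprn_ege1.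
  by have := s_bound; rewrite /q /K; lra.
have N2 : N.+2%:R <= 3 * q ^+ 2.
  have : 1 <= q ^+ 2 by rewrite exprn_ege1.
  by rewrite -natr1; lra.
have lnq : ln q <= ln K + 3 * L + 4 * U.
  apply: (@le_trans _ _ (ln (K * (D ^+ 3 * u ^+ 4)))).
    by rewrite ler_ln ?posrE// !mulr_gt0 ?exprn_gt0.
  rewrite lnM ?posrE ?mulr_gt0 ?exprn_gt0// [ln (D ^+ 3 * _)]lnM ?posrE ?exprn_gt0//.
  by rewrite !lnXn// -/L -/U !mulr_natl addrA.
apply: (@le_trans _ _ (ln (3 * q ^+ 2))).
  by rewrite ler_ln ?posrE// mulr_gt0 ?exprn_gt0.
rewrite lnM ?posrE ?exprn_gt0// lnXn// mulr2n.
have LU1 : 1 <= L * U by rewrite mulr_ege1.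
have k3 : 0 <= ln 3 :> R by rewrite ln_ge0// ler1n.
have k9 : 0 <= ln K by exact: ln_ge0.
have L_le : L <= L * U by rewrite ler_peMr// ltW.
have U_le : U <= L * U by rewrite ler_peMl// ltW.
by nra.
Qed.

(** The product [sqrt T * sqrt (L U)] equals [D^(1/2) L^(3/4 + e/4) u^(1/4) U^(1 + e/2)]. Inserting
    [u <= 5 La] and [U <= 3 ln La] yields the factors of the theorem; the constant is
    [5^(1/4) 3^(3/2)], written as an exponential because the comparison is made between
    logarithms. *)
Lemma growth_estimate :
  Num.sqrt (expR u) * Num.sqrt (ln (1 - r)^-1 * ln u) <=
  (Num.sqrt (54 * C0) * expR (ln 5 / 4 + 3 / 2 * ln 3)) *
  (mu / (1 - r) `^ (1 / 2) * ln (1 - r)^-1 `^ (3 / 4 + delta) *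
   ln (mu / (1 - r)) `^ (1 / 4) * ln (ln (mu / (1 - r))) `^ (1 + delta)).
Proof.
rewrite -/D -/L -/U -/La.
have T0 : 0 < T by exact: lt_le_trans T1.
have C00 : 0 < C0 by exact: lt_le_trans C01.
have lLa0 : 0 < ln La by exact: lt_le_trans lnLa1.
have d0 : 0 < 1 - r by rewrite subr_gt0.
have LU0 : 0 < L * U by exact: mulr_gt0.
have p1 : 0 <= 54 * C0 by rewrite mulr_ge0// ltW.
have p3 : 0 <= 54 * C0 * mu ^+ 2 := mulr_ge0 p1 (sqr_ge0 mu).
have step1 : Num.sqrt (expR u) <= Num.sqrt (54 * C0) * (mu * Num.sqrt T).
  have -> : Num.sqrt (54 * C0) * (mu * Num.sqrt T) = Num.sqrt (54 * C0 * mu ^+ 2 * T).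
    rewrite (sqrtrM _ p3) (sqrtrM _ p1).
    by rewrite sqrtr_sqr ger0_norm ?(ltW mu0)// mulrA.
  by rewrite ler_sqrt ?(mulr_ge0 p3 (ltW T0)).
have step2 : Num.sqrt T * Num.sqrt (L * U) <= expR (ln 5 / 4 + 3 / 2 * ln 3) *
   ((1 - r) `^ (1 / 2))^-1 * L `^ (3 / 4 + delta) * La `^ (1 / 4) * ln La `^ (1 + delta).
  have U_le : U <= ln 5 + ln La.
    by rewrite /U -lnM ?posrE// ler_ln ?posrE ?mulr_gt0//; exact: u_le_La.
  have lU_le : ln U <= ln 3 + ln (ln La).
    rewrite -lnM ?posrE// ler_ln ?posrE ?mulr_gt0//.
    by apply: le_trans U_le _; have := ln5_le; have := lnLa1; rewrite -/La; lra.
  rewrite -ler_ln ?posrE ?mulr_gt0 ?sqrtr_gt0 ?invr_gt0 ?powR_gt0 ?expR_gt0//.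
  rewrite -!powR12_sqrt ?(ltW T0) ?(ltW LU0)//.
  rewrite !lnM ?posrE ?mulr_gt0 ?invr_gt0 ?powR_gt0 ?expR_gt0//.
  rewrite lnV ?posrE ?powR_gt0// expRK !ln_powR lnM ?posrE// lnT.
  have -> : ln (1 - r) = - L by rewrite /L /D lnV ?posrE// opprK.
  have lL0 : 0 <= ln L by exact: ln_ge0.
  have llLa0 : 0 <= ln (ln La) by apply: ln_ge0; exact: lnLa1.
  have k3 : 0 <= ln 3 :> R by rewrite ln_ge0// ler1n.
  have t1 : (2 + e) / 2 * ln U <= 3 / 2 * ln 3 + (1 + delta) * ln (ln La).
    apply: (@le_trans _ _ ((2 + e) / 2 * (ln 3 + ln (ln La)))).
      by apply: ler_wpM2l => //; have := e0; lra.
    have q1 : e * ln 3 <= 1 * ln 3 by apply: ler_wpM2r.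
    have q2 : e * ln (ln La) <= delta * ln (ln La) by apply: ler_wpM2r.
    have q3 : 0 <= delta * ln (ln La).
      by apply: mulr_ge0 => //; apply: le_trans edelta; exact: ltW.
    by rewrite mulrDr; move: q1 q2 q3; rewrite mul1r => *; lra.
  have t2 : e * ln L <= delta * ln L by apply: ler_wpM2r.
  have t3 : 0 <= e * ln L by apply: mulr_ge0 => //; exact: ltW.
  by move: t1 t2 t3; lra.
apply: (@le_trans _ _ (Num.sqrt (54 * C0) * (mu * Num.sqrt T) * Num.sqrt (L * U))).
  by apply: ler_wpM2r => //; exact: sqrtr_ge0.
have -> : Num.sqrt (54 * C0) * (mu * Num.sqrt T) * Num.sqrt (L * U) =
  Num.sqrt (54 * C0) * mu * (Num.sqrt T * Num.sqrt (L * U)) by ring.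
apply: (@le_trans _ _ (Num.sqrt (54 * C0) * mu * (expR (ln 5 / 4 + 3 / 2 * ln 3) *
   ((1 - r) `^ (1 / 2))^-1 * L `^ (3 / 4 + delta) * La `^ (1 / 4) * ln La `^ (1 + delta)))).
  by apply: ler_wpM2l => //; rewrite mulr_ge0 ?sqrtr_ge0 ?(ltW mu0).
by rewrite le_eqVlt; apply/orP; left; apply/eqP; ring.
Qed.

End estimate.

(** * The random Wiman-type inequality *)

Lemma convergent_power_series_disk_bounded (R : realType) (a : nat -> R[i]) :
  (forall z, unit_disk z -> cvgn (power_series a z)) ->
  disk_bounded (fun n => modulus (a n)).
Proof.
move=> ca rho /andP[r0 r1].
have mrho : modulus (rho%:C) = rho.
  by rewrite /modulus/= expr0n/= addr0 sqrtr_sqr ger0_norm// ltW.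
have rd : unit_disk (rho%:C) by rewrite /unit_disk /mkset mrho.
have /cvg_series_cvg_0/cvg_modulusP/(_ 1 ltr01) [n0 _ Hn0] := ca _ rd.
exists (1 + \sum_(0 <= k < n0) modulus (a k) * rho ^+ k) => n.
have s0 k : 0 <= modulus (a k) * rho ^+ k.
  by apply: mulr_ge0; [exact: modulus_ge0|rewrite exprn_ge0// ltW].
rewrite ger0_norm ?modulus_ge0//; have [nn0|nn0] := leqP n0 n.
  have := Hn0 n nn0; rewrite sub0r modulusN modulusM modulusX mrho => /ltW h.
  by apply: le_trans h _; rewrite lerDl sumr_ge0.
rewrite -[leLHS]add0r lerD// big_mkord (bigD1 (Ordinal nn0))//= lerDl.
by apply: sumr_ge0.
Qed.

(** [sup] takes a default value on unbounded sets, so boundedness of the terms has to be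
    supplied. *)
Lemma maximum_term_ge (R : realType) (a : nat -> R[i]) (r : R) n :
  disk_bounded (fun n => modulus (a n)) -> 0 < r < 1 ->
  modulus (a n) * r ^+ n <= maximum_term a r.
Proof.
move=> ha r01; have [K HK] := ha r r01.
apply: ub_le_sup; last by exists n.
exists K => _ [k _ <-]; apply: le_trans (HK k).
by rewrite ger0_norm ?modulus_ge0.
Qed.

Section main_estimate.
Context (R : realType).
Variable a : nat -> R[i].
Hypothesis a_bounded : disk_bounded (fun n => modulus (a n)).

(* The constant term is enlarged so that ln (gen_fun b x) >= e. *)
Let A : R := expR (expR 1).
Let b (n : nat) : R := modulus (a n) ^+ 2 + (n == 0)%N%:R * A.

Let A0 : 0 < A.
Proof. exact: expR_gt0. Qed.

Let b_ge0 n : 0 <= b n.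
Proof. by apply: addr_ge0; [exact: sqr_ge0|apply: mulr_ge0 => //; exact: ltW]. Qed.

Let b_bounded : disk_bounded b.
Proof.
move=> rho r01; have [K HK] := disk_boundedM a_bounded a_bounded r01.
have /andP[r0 r1] := r01.
exists (K + A) => n; rewrite ger0_norm// /b mulrDl; apply: lerD.
  by apply: le_trans (HK n); rewrite -expr2 ger0_norm// sqr_ge0.
have r1n : rho ^+ n <= 1 by rewrite exprn_ile1 // ltW.
have r0n : 0 <= rho ^+ n by rewrite exprn_ge0// ltW.
rewrite -[leRHS]mulr1; apply: ler_pM => //; first by rewrite mulr_ge0// ltW.
by case: (n == 0)%N; rewrite ?mul0r ?mul1r// ltW.
Qed.

Let b0 : expR (expR 1) <= b 0.
Proof. by rewrite /b eqxx mul1r lerDr sqr_ge0. Qed.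

Let sum_b_geA (r : R) n : 0 < r < 1 ->
  A + \sum_(0 <= k < n) modulus (a k) ^+ 2 * (r ^+ k) ^+ 2 <= gen_fun b (r ^+ 2).
Proof.
move=> /andP[r0 r1].
have x01 : 0 <= r ^+ 2 < 1 by rewrite sqr_ge0/= expr_lt1// ltW.
(* One term more is taken so that the index 0, which carries [A], is present also when [n = 0]. *)
apply: le_trans (partial_sum_le_gen_fun n.+1 b_bounded b_ge0 x01).
apply: (@le_trans _ _ (A + \sum_(0 <= k < n.+1) modulus (a k) ^+ 2 * (r ^+ k) ^+ 2)).
  rewrite lerD2l big_nat_recr//= lerDl; apply: mulr_ge0; exact: sqr_ge0.
rewrite !big_nat_recl//= addrA; apply: lerD.
  by rewrite /b eqxx !expr0 expr1n !mulr1 mul1r addrC.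
apply: ler_sum => k _; rewrite -!exprM mulnC.
apply: ler_wpM2r; first by rewrite exprM exprn_ge0// sqr_ge0.
by rewrite /b lerDl; apply: mulr_ge0 => //; exact: ltW.
Qed.

(** Uses [(k+1)^2 <= 2 (k^2 + 1)]; this is the source of [q = 2 (s + m^2 + 1)]. *)
Let sum_sqr_le (r : R) n : 0 < r < 1 ->
  \sum_(0 <= k < n) k.+1%:R ^+ 2 * (modulus (a k) ^+ 2 * (r ^+ k) ^+ 2) <=
  gen_fun b (r ^+ 2) * (2 * (gen_var b (r ^+ 2) + gen_mean b (r ^+ 2) ^+ 2 + 1)).
Proof.
move=> /andP[r0 r1].
have x01 : 0 <= r ^+ 2 < 1 by rewrite sqr_ge0/= expr_lt1// ltW.
have h1 := second_moment_le b_bounded b_ge0 b0 n x01.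
have h0 := partial_sum_le_gen_fun n b_bounded b_ge0 x01.
apply: (@le_trans _ _ (2 * (\sum_(0 <= k < n) k%:R ^+ 2 * (b k * (r ^+ 2) ^+ k)
   + \sum_(0 <= k < n) b k * (r ^+ 2) ^+ k))); last by lra.
rewrite -big_split/= mulr_sumr; apply: ler_sum => k _.
set w := modulus (a k) ^+ 2 * _.
have w0 : 0 <= w by apply: mulr_ge0; exact: sqr_ge0.
have wb : w <= b k * (r ^+ 2) ^+ k.
  rewrite /w -!exprM mulnC; apply: ler_wpM2r; first by rewrite exprM exprn_ge0// sqr_ge0.
  by rewrite /b lerDl; apply: mulr_ge0 => //; exact: ltW.
have k0 : 0 <= k%:R :> R by [].
apply: (@le_trans _ _ (2 * (k%:R ^+ 2 + 1) * w)).
  by apply: ler_wpM2r => //; rewrite -natr1; have := sqr_ge0 (k%:R - 1 : R); lra.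
rewrite -mulrA; apply: ler_wpM2l => //; rewrite mulrDl mul1r; apply: lerD => //.
by apply: ler_wpM2l => //; exact: sqr_ge0.
Qed.

Variables (delta kappa : R).
Hypothesis delta0 : 0 < delta.
Hypothesis kappa0 : 0 <= kappa.
Hypothesis a_neq0 : exists p, a p != 0.

(** The order of quantifiers is the point: [E] and [C] are fixed before [x], [W] and [Z], which
    stand for one realisation of the sequence and its random constants; only [r0] depends on
    them. *)
Lemma random_maximum_modulus_bound : exists (E : set R) (C : R),
  [/\ measurable E, E `<=` `[0, 1[, finite_log_measure E, 0 < C &
  forall (x : nat -> R[i]) (W Z : R), 0 <= Z ->
    (forall n, \sum_(0 <= k < n) modulus (x k) ^+ 2 / (k.+1%:R * Num.sqrt k.+1%:R) <= W) ->
    (forall N i (j : 'I_4), complex.Re (\sum_(0 <= k < N.+1)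
        ('i ^+ j * (a k * @grid_point R (N.+1 ^ 3) i ^+ k)) * x k) <=
      Num.sqrt (expR (expR 1) + \sum_(0 <= k < N.+1)
        modulus ('i ^+ j * (a k * @grid_point R (N.+1 ^ 3) i ^+ k)) ^+ 2) *
      (kappa * Num.sqrt (ln N.+2%:R) + Z)) ->
    exists r0 : R, 0 < r0 < 1 /\ forall r : R, r0 <= r < 1 -> ~ E r ->
      (maximum_modulus (power_series_sum (fun n => (a n * x n)%R)) r <=
           (C * (maximum_term a r / (1 - r) `^ (1 / 2))
              * ln (1 / (1 - r)) `^ (3 / 4 + delta)
              * ln (maximum_term a r / (1 - r)) `^ (1 / 4)
              * ln (ln (maximum_term a r / (1 - r))) `^ (1 + delta))%R%:E)%E].
Proof.
pose e := Num.min delta 1.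
have e0 : 0 < e by rewrite lt_min delta0 ltr01.
have e1 : e <= 1 by rewrite ge_min lexx orbT.
have edelta : e <= delta by rewrite ge_min lexx.
have [E [mE E01 fE HE]] := moments_growth b_bounded b_ge0 b0 e0.
have [p ap] := a_neq0.
(* A positive lower bound of the maximum term for [r >= 1/2]; with it the artificial [A] is at most
   [(A / c^2) mu^2], hence [C0]. *)
pose c := modulus (a p) * 2^-1 ^+ p.
have map0 : 0 < modulus (a p).
  rewrite lt_neqAle modulus_ge0 andbT eq_sym; apply/eqP => /ComplexField.Normc.eq0_normc.
  by move=> h; rewrite h eqxx in ap.
have c0 : 0 < c by rewrite mulr_gt0// exprn_gt0// invr_gt0.
pose C0 := 1 + A / c ^+ 2.
have C01 : 1 <= C0 by rewrite lerDl divr_ge0 ?sqr_ge0// ltW.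
pose Ca : R := ln 3 + 2 * (ln (2 * (72 * 64 + 17)) + 7).
have Ca0 : 0 <= Ca.
  by rewrite /Ca addr_ge0 ?mulr_ge0 ?addr_ge0// ln_ge0//; lra.
pose C1 := Num.sqrt (54 * C0) * expR (ln 5 / 4 + 3 / 2 * ln 3).
have C10 : 0 < C1 by rewrite mulr_gt0 ?expR_gt0// sqrtr_gt0 mulr_gt0// (lt_le_trans _ C01).
(* The summand 1 is the room in which the random quantity [B] is absorbed. *)
pose C2 := 2 * (kappa * Num.sqrt Ca) + 1.
have C20 : 0 < C2 by rewrite ltr_wpDl// !mulr_ge0// sqrtr_ge0.
exists E, (C2 * C1); split => //; first exact: mulr_gt0.
move=> x W Z Z0 HW HZ.
have W0 : 0 <= W by have := HW 0; rewrite big_nil.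
pose B := 2 * Z + 5 * (1 + W).
have B0 : 0 <= B by rewrite /B; lra.
(* A threshold for [ln (1/(1-r))]: [B^2] gives [B <= sqrt L], the third summand gives [La_ge],
   [expR 1] gives [lnLa1], and [|ln c|] compensates a negative [ln mu]. *)
pose Lmin := 1 + B ^+ 2 + `|2 * ln (54 * C0) + 5| + `|ln c| + expR 1.
have Lmin0 : 0 < Lmin.
  by rewrite /Lmin; have := sqr_ge0 B; have := normr_ge0 (2 * ln (54 * C0) + 5);
    have := normr_ge0 (ln c); have := expR_gt0 (1 : R); lra.
exists (Num.max 2^-1 (1 - expR (- Lmin))); split.
  rewrite lt_max invr_gt0 ltr0n/= gt_max invf_lt1 ?ltr1n//=.
  by rewrite ltrBlDr ltrDl expR_gt0.
move=> r; rewrite ge_max => /andP[/andP[r12 rL] r1] Er.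
have r0 : 0 < r by apply: lt_le_trans r12; rewrite invr_gt0.
have r01 : 0 < r < 1 by rewrite r0.
have x01 : 0 <= r ^+ 2 < 1 by rewrite sqr_ge0/= expr_lt1// ltW.
have d0 : 0 < 1 - r by rewrite subr_gt0.
have L_ge : Lmin <= ln (1 - r)^-1.
  rewrite lnV ?posrE// lerNr -[leRHS]expRK ler_ln ?posrE ?expR_gt0//.
  by rewrite lerBlDr addrC -lerBlDr.
set mu := maximum_term a r.
have mu_ge n : modulus (a n) * r ^+ n <= mu by exact: maximum_term_ge.
have c_mu : c <= mu.
  apply: le_trans (mu_ge p); apply: ler_wpM2l; first exact: ltW.
  by rewrite lerXn2r ?nnegrE ?invr_ge0// ltW.
have mu0 : 0 < mu by exact: lt_le_trans c_mu.
set s := gen_var b (r ^+ 2); set m := gen_mean b (r ^+ 2).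
pose Phi := gen_fun b (r ^+ 2); pose u := ln Phi.
have Phi_ge : expR (expR 1) <= Phi := gen_fun_ge b_bounded b_ge0 b0 x01.
have Phi0 : 0 < Phi by apply: lt_le_trans Phi_ge; exact: expR_gt0.
have s0 : 0 <= s := gen_var_ge0 b_bounded b_ge0 b0 x01.
have m0 : 0 <= m := gen_mean_ge0 b_bounded b_ge0 b0 x01.
have u_ge : expR 1 <= u by rewrite -[leLHS]expRK ler_ln ?posrE ?expR_gt0.
have [m_le s_le] := HE r r01 Er.
have uE : expR u = Phi by rewrite lnK ?posrE.
have u_le : expR u <= 2 * (2 * Num.sqrt (2 * s + 1) + 1) * (C0 * mu ^+ 2).
  rewrite uE; apply: (gen_fun_chebyshev b_bounded b_ge0 b0 x01) => n.
  have h1 : modulus (a n) ^+ 2 * (r ^+ 2) ^+ n <= mu ^+ 2.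
    rewrite -exprM mulnC exprM -exprMn lerXn2r ?nnegrE ?(ltW mu0) ?mu_ge//.
    by apply: mulr_ge0; [exact: modulus_ge0|rewrite exprn_ge0// ltW].
  have h2 : (n == 0)%N%:R * A * (r ^+ 2) ^+ n <= A / c ^+ 2 * mu ^+ 2.
    apply: (@le_trans _ _ A).
      have q1 : (r ^+ 2) ^+ n <= 1 by rewrite exprn_ile1//; case/andP: x01 => // *; exact: ltW.
      have q0 : 0 <= (r ^+ 2) ^+ n by rewrite exprn_ge0 ?sqr_ge0.
      rewrite -[leRHS]mulr1; apply: ler_pM => //; first by rewrite mulr_ge0// ltW.
      by case: (n == 0)%N; rewrite ?mul0r ?mul1r// ltW.
    rewrite mulrAC ler_pdivlMr ?exprn_gt0//; apply: ler_wpM2l; first exact: ltW.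
    by rewrite lerXn2r ?nnegrE ?(ltW c0) ?(ltW mu0).
  by rewrite /b /C0 !mulrDl mul1r; exact: lerD.
have [L1 LB] : 1 <= ln (1 - r)^-1 /\ B ^+ 2 <= ln (1 - r)^-1.
  move: L_ge; rewrite /Lmin; have := sqr_ge0 B.
  have := normr_ge0 (2 * ln (54 * C0) + 5); have := normr_ge0 (ln c).
  by have := expR_gt0 (1 : R); move=> *; split; lra.
have [La_ge lnLa1] : 2 * ln (54 * C0) + 5 <= ln (mu / (1 - r)) /\
    1 <= ln (ln (mu / (1 - r))).
  have lc : ln c <= ln mu by rewrite ler_ln ?posrE.
  have E1 : ln (mu / (1 - r)) = ln mu + ln (1 - r)^-1 by rewrite lnM ?posrE ?invr_gt0.
  have n1 := ler_norm (2 * ln (54 * C0) + 5).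
  have n2 : - ln c <= `|ln c| by rewrite -normrN ler_norm.
  have n3 := expR_gt0 (1 : R); have n4 := sqr_ge0 B.
  have n5 := normr_ge0 (2 * ln (54 * C0) + 5).
  have La_e : expR 1 <= ln (mu / (1 - r)).
    by move: L_ge; rewrite E1 /Lmin => *; lra.
  split; first by move: L_ge; rewrite E1 /Lmin => *; lra.
  rewrite -[leLHS]expRK ler_ln ?posrE ?expR_gt0//.
  exact: lt_le_trans n3 La_e.
pose q := 2 * (s + m ^+ 2 + 1).
have q0 : 0 <= q by rewrite /q mulr_ge0// addr_ge0// addr_ge0// sqr_ge0.
pose N := Num.truncn (q ^+ 2).
have qN : q ^+ 2 <= N.+1%:R by apply: ltW; exact: truncnS_gt.
have N_le : N.+1%:R <= q ^+ 2 + 1.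
  by rewrite -natr1 lerD2r; have /andP[] := truncn_itv (sqr_ge0 q).
have U1 : 1 <= ln u.
  by rewrite -[leLHS]expRK ler_ln ?posrE ?expR_gt0//; apply: lt_le_trans u_ge; exact: expR_gt0.
set L := ln (1 - r)^-1 in L1 LB L_ge *.
have LU0 : 0 <= L * ln u by rewrite mulr_ge0// (le_trans ler01).
have degN : ln N.+2%:R <= Ca * (L * ln u).
  exact: (degree_estimate e0 e1 r1 m0 s0 u_ge L1 m_le s_le N_le).
pose G := kappa * Num.sqrt (ln N.+2%:R) + Z.
have G0 : 0 <= G by rewrite addr_ge0// mulr_ge0// sqrtr_ge0.
have G_le : 2 * G + 5 * (1 + W) <= C2 * Num.sqrt (L * ln u).
  have g1 : Num.sqrt (ln N.+2%:R) <= Num.sqrt Ca * Num.sqrt (L * ln u).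
    by rewrite -sqrtrM// ler_sqrt// mulr_ge0.
  have g2 : B <= Num.sqrt (L * ln u).
    rewrite -[leLHS](ger0_norm B0) -sqrtr_sqr ler_sqrt//; apply: le_trans LB _.
    by rewrite ler_peMr// (le_trans ler01).
  have g3 := ler_wpM2l kappa0 g1.
  by move: g2 g3; rewrite /G /C2 /B mulrA => *; lra.
have est := growth_estimate e0 e1 edelta C01 r1 mu0 m0 u_ge L1 m_le s_le u_le La_ge lnLa1.
apply: ge_ereal_sup => _ [z /= zr <-]; rewrite lee_fin.
have x_bounded : disk_bounded (fun n => modulus (a n * x n)).
  apply: (@disk_bounded_le _ (fun n => n.+1%:R * modulus (a n)) _ (1 + W)).
  - by rewrite addr_ge0.
  - move=> n; rewrite modulusM !ger0_norm ?mulr_ge0 ?modulus_ge0//.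
    rewrite mulrA [leRHS]mulrC; apply: ler_wpM2l; first exact: modulus_ge0.
    exact: modulus_le_weighted_sum.
  - exact: disk_bounded_mulS.
apply: (@le_trans _ _ (Num.sqrt Phi * (2 * G + 5 * (1 + W)))).
  apply: modulus_lim_le; first by apply: power_series_cvg => //; rewrite /unit_disk/= zr.
  exists N.+1 => // M /= NM.
  apply: (@random_series_bound R a x A Phi q r W G N z) => //.
  - exact: ltW.
  - by move=> n; exact: sum_b_geA.
  - by move=> n; exact: sum_sqr_le.
apply: (@le_trans _ _ (Num.sqrt Phi * (C2 * Num.sqrt (L * ln u)))).
  by apply: ler_wpM2l => //; exact: sqrtr_ge0.
have -> : Num.sqrt Phi * (C2 * Num.sqrt (L * ln u)) =
   C2 * (Num.sqrt (expR u) * Num.sqrt (L * ln u)) by rewrite uE; ring.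
apply: le_trans (ler_wpM2l (ltW C20) est) _.
by rewrite le_eqVlt; apply/orP; left; apply/eqP; rewrite (div1r (1 - r)) /C1 /L /mu; ring.
Qed.

End main_estimate.

Theorem theorem1p2 (d : measure_display) (T : measurableType d) (R : realType)
    (P : probability T R) (f : R[i] -> R[i]) (a : nat -> R[i])
    (X : nat -> T -> R[i])
    (f_analytic : analytic_in_disk f)
    (f_series : forall z, unit_disk z -> power_series a z @ \oo --> f z)
    (f_nonconstant : ~ exists c, forall z, unit_disk z -> f z = c)
    (X_rv : forall n, complex_random_variable (X n))
    (X_independent : independent_sequence P X)
    (X_centred : forall n, centred P (X n))
    (X_subgaussian : subgaussian_sequence P X) :
  {ae P, forall w,
    (forall z, unit_disk z -> cvgn (power_series (random_coefficients a X w) z)) /\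
    analytic_in_disk (power_series_sum (random_coefficients a X w))} /\
  forall delta : R, 0 < delta ->
    exists (E : set R) (C : R),
      [/\ measurable E, E `<=` `[0, 1[, finite_log_measure E, 0 < C &
      {ae P, forall w, exists r0 : R, 0 < r0 < 1 /\
        forall r : R, r0 <= r < 1 -> ~ E r ->
          (maximum_modulus (power_series_sum (random_coefficients a X w)) r <=
           (C * (maximum_term a r / (1 - r) `^ (1 / 2))
              * ln (1 / (1 - r)) `^ (3 / 4 + delta)
              * ln (maximum_term a r / (1 - r)) `^ (1 / 4)
              * ln (ln (maximum_term a r / (1 - r))) `^ (1 + delta))%R%:E)%E}].
Proof.
have a_bounded : disk_bounded (fun n => modulus (a n)).
  apply: convergent_power_series_disk_bounded => z z1.
  by apply/cvg_ex; exists (f z); exact: f_series.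
(* If all coefficients vanished, [f] would be the constant 0 on the disk. *)
have a_neq0 : exists p, a p != 0.
  apply: contrapT => /forallNP a0; apply: f_nonconstant; exists 0 => z z1.
  rewrite -(cvg_lim _ (f_series z z1))//; apply: lim_near_cst => //.
  apply: nearW => n; rewrite /power_series/series/= big1// => k _.
  by have /negP/negPn/eqP -> := a0 k; rewrite mul0r.
have [K [tau [K0 [tau0 XK]]]] := X_subgaussian.
have weighted_ae : {ae P, forall w, exists W, forall n,
    \sum_(0 <= k < n) modulus (X k w) ^+ 2 / (k.+1%:R * Num.sqrt k.+1%:R) <= W}.
  pose M2 := 2 * tau ^+ 2 * subgaussian_moment K.
  have k0 k : 0 <= (k.+1%:R * Num.sqrt k.+1%:R)^-1 :> R.
    by rewrite invr_ge0 mulr_ge0 ?sqrtr_ge0.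
  have M20 : 0 <= M2.
    apply: mulr_ge0; first by apply: mulr_ge0 => //; exact: sqr_ge0.
    exact: le_trans ler01 (subgaussian_moment_ge1 (ltW K0)).
  apply: (@ae_bounded_sums _ _ _ P
    (fun k w => modulus (X k w) ^+ 2 / (k.+1%:R * Num.sqrt k.+1%:R))
    (fun k => M2 * (k.+1%:R * Num.sqrt k.+1%:R)^-1) (M2 * 3)).
  - move=> k; apply: measurable_funM => //; apply: measurable_funX.
    exact: measurable_modulus.
  - by move=> k w; rewrite mulr_ge0 ?sqr_ge0.
  - move=> k; under eq_integral do rewrite mulrC EFinM.
    rewrite ge0_integralZl//; last 2 first.
    + apply/measurable_EFinP; apply: measurable_funX; exact: measurable_modulus.
    + by move=> w _; rewrite lee_fin sqr_ge0.
    rewrite [M2 / _]mulrC EFinM; apply: lee_wpmul2l; first by rewrite lee_fin.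
    exact: (subgaussian_sqr_moment (X_rv k) K0 tau0 (XK k)).
  - by move=> n; rewrite -mulr_sumr; apply: ler_wpM2l => //; exact: sum_inv_pow32_le3.
split.
  (* The bounded weighted sums give [|X_n| <= (1+W)(n+1)], so the random coefficients keep the
     radius of convergence at least 1. *)
  apply: filterS weighted_ae => w [W HW].
  have W0 : 0 <= W by have := HW 0; rewrite big_nil.
  have x_bounded : disk_bounded (fun n => modulus (random_coefficients a X w n)).
    apply: (@disk_bounded_le _ (fun n => n.+1%:R * modulus (a n)) _ (1 + W)).
    - by rewrite addr_ge0.
    - move=> n; rewrite modulusM !ger0_norm ?mulr_ge0 ?modulus_ge0//.
      rewrite mulrA [leRHS]mulrC; apply: ler_wpM2l; first exact: modulus_ge0.
      exact: (@modulus_le_weighted_sum _ (fun k => X k w) W n HW).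
    - exact: disk_bounded_mulS.
  by split; [move=> z; exact: power_series_cvg|exact: power_series_analytic].
move=> delta delta0.
pose kappa := 4 * tau ^+ 2 * subgaussian_moment K + 8.
have kappa0 : 0 <= kappa.
  apply: addr_ge0 => //; apply: mulr_ge0; first by apply: mulr_ge0 => //; exact: sqr_ge0.
  exact: le_trans ler01 (subgaussian_moment_ge1 (ltW K0)).
have [E [C [mE E01 fE C0 H]]] := random_maximum_modulus_bound a_bounded delta0 kappa0 a_neq0.
exists E, C; split => //.
(* An index is a grid point together with a rotation; the positive constant is the [A] added to the
   coefficient [b 0]. *)
have grid_ae := random_sums_uniform_bound X_rv X_independent X_centred K0 tau0 XK
  (fun N (i : bool * bool * ('I_(N.+1 ^ 3).+1 * 'I_(N.+1 ^ 3).+1) * 'I_4) n =>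
     'i ^+ i.2 * (a n * grid_point i.1 ^+ n))
  (expR_gt0 (expR 1 : R)) card_grid_index.
(* Neither event mentions [r]; on their intersection the deterministic bound holds for all [r] close
   to 1 outside [E]. *)
apply: filterS2 weighted_ae grid_ae => w [W HW] [Z Z0 HZ].
exact: (H (fun n => X n w) W Z Z0 HW (fun N i j => HZ N (i, j))).
Qed.
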